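(* Let $\mathcal{F}$ be a separable Hilbert space, let $h:\mathbb{R}^p\to\mathcal{F}$ be differentiable with locally Lipschitz differential $Dh$, and let $R:\mathcal{F}\to\mathbb{R}_+$ be differentiable with Lipschitz gradient and strongly convex. Let $w_0\in\mathbb{R}^p$ be such that $h(w_0)=0$ and $\operatorname{rank}Dh(w)$ is constant on a neighborhood of $w_0$. For $\alpha>0$ let $w_\alpha$ be the gradient flow, started from $w_0$, of $F_\alpha(w):=\frac1{\alpha^2}R(\alpha h(w))$. Then there exists $\alpha_0>0$ such that for all $\alpha\ge\alpha_0$ the gradient flow $w_\alpha(t)$ converges at a geometric rate (asymptotically independent of $\alpha$) to a local minimum of $F_\alpha$.
   Context: $Dh(w):\mathbb{R}^p\to\mathcal{F}$ denotes the differential of $h$ at $w$, a continuous linear map, and $Dh(w)^\intercal$ its adjoint; local Lipschitz continuity of $w\mapsto Dh(w)$ is with respect to the operator norm. The gradient flow $(w_\alpha(t))_{t\ge 0}$ of $F_\alpha$ is the path in $\mathbb{R}^p$ that satisfies $w_\alpha(0)=w_0$ and solves $$w_\alpha'(t)=-\nabla F_\alpha(w_\alpha(t))=-\frac1\alpha Dh(w_\alpha(t))^\intercal\nabla R(\alpha h(w_\alpha(t))).$$ *)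

(* Defs.v *)
From HB Require Import structures.
From mathcomp Require Export all_boot all_order all_algebra.
From mathcomp Require Export all_classical all_reals all_analysis.

Set Implicit Arguments.
Unset Strict Implicit.
Unset Printing Implicit Defensive.

Export Order.TTheory GRing.Theory Num.Theory.
Export numFieldNormedType.Exports.

Local Open Scope classical_set_scope.
Local Open Scope ring_scope.

Definition separable_space (T : topologicalType) : Prop :=
  exists2 D : set T, countable D & dense D.

(* The library norm on 'rV[R]_p is the sup norm (with the same topology);
   gradients and metric estimates on R^p use the Euclidean structure. *)
Definition edot (R : realType) (p : nat) (u v : 'rV[R]_p) : R :=
  (u *m v^T) 0 0.

Definition enorm (R : realType) (p : nat) (v : 'rV[R]_p) : R :=
  Num.sqrt (edot v v).

(* The supremum is finite for the linear maps it is applied to, their domain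
   being finite-dimensional. *)
Definition opnorm (R : realType) (p : nat) (V : normedModType R)
    (f : 'rV[R]_p -> V) : R :=
  sup [set `|f v| | v in [set v | enorm v <= 1]].

Definition locally_lipschitz_diff (R : realType) (p : nat)
    (V : normedModType R) (h : 'rV[R]_p -> V) : Prop :=
  forall w : 'rV[R]_p, exists k : R, exists2 U, nbhs w U &
    forall u v, U u -> U v ->
      opnorm ('d h u \- 'd h v) <= k * enorm (u - v).

(* The range of f has a basis of r vectors. *)
Definition has_rank (R : realType) (U V : lmodType R) (f : U -> V)
    (r : nat) : Prop :=
  exists b : 'I_r -> V,
    (forall c : 'I_r -> R, \sum_i c i *: b i = 0 -> forall i, c i = 0) /\
    range f = [set \sum_i c i *: b i | c in [set: 'I_r -> R]].

(* g is the Riesz representative of 'd f x for the inner product dot. *)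
Definition is_gradient (R : realType) (V : normedModType R)
    (dot : V -> V -> R) (f : V -> R^o) (x g : V) : Prop :=
  differentiable f x /\ forall v : V, 'd f x v = dot g v.

Definition lipschitz_gradient (R : realType) (V : normedModType R)
    (dot : V -> V -> R) (f : V -> R^o) : Prop :=
  exists2 G : V -> V, (forall x, is_gradient dot f x (G x)) & lipschitz G.

Definition strongly_convex (R : realType) (V : normedModType R)
    (f : V -> R^o) : Prop :=
  exists2 mu : R, 0 < mu &
    forall (x y : V) (t : R), 0 <= t <= 1 ->
      f (t *: x + (1 - t) *: y) <=
        t * f x + (1 - t) * f y - mu / 2 * t * (1 - t) * `|x - y| ^+ 2.

Definition objective (R : realType) (p : nat) (V : normedModType R)
    (h : 'rV[R]_p -> V) (L : V -> R^o) (alpha : R) : 'rV[R]_p -> R^o :=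
  fun w => alpha ^- 2 * L (alpha *: h w).

(* The derivative of w at t is relative to [0, +oo[, hence one-sided at 0;
   the values of w at negative times are irrelevant. *)
Definition gradient_flow (R : realType) (p : nat) (f : 'rV[R]_p -> R^o)
    (w0 : 'rV[R]_p) (w : R -> 'rV[R]_p) : Prop :=
  w 0 = w0 /\
  forall t : R, 0 <= t ->
    exists2 g : 'rV[R]_p, is_gradient (@edot R p) f (w t) g &
      (s - t)^-1 *: (w s - w t)
        @[s --> within [set s : R | 0 <= s] t^'] --> - g.

Definition local_minimum (R : realType) (T : topologicalType)
    (f : T -> R^o) (x : T) : Prop :=
  \forall y \near x, f x <= f y.

(* Main.v *)
Require Import Defs.
From HB Require Import structures.
From mathcomp Require Import ring lra.

(** Write [f] for the objective with parameter [alpha]. The proof rests on a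
    Polyak-Lojasiewicz inequality near [w0]: there are a ball around [w0] and a
    constant [c > 0], both independent of [alpha], such that for all large
    [alpha] and all [v], [w] in the ball
      [2 * c * (f w - f v) <= |grad f w| ^+ 2].
    This is [objective_gradient_inequality].

    It holds because the image of a map of constant rank is locally a manifold,
    so that [h v - h w] is tangent at [h w] up to an error of second order in its
    own length ([constant_rank_increments]), and because [L] is strongly convex.
    The term linear in [h v - h w] is then seen by the gradient of [f], and the
    curvature error is absorbed by strong convexity as soon as the gradient of
    [L] at [alpha *: h w], divided by [alpha], is small: since [h w0 = 0], this
    is the case near [w0] for large [alpha]. Instead of the constant rank theorem
    and its charts, [fibre_correction] moves [v] along a fibre of [h] until it
    faces [w].

    Under such an inequality a gradient flow contracts the gap [f - inf f] at the
    rate [2 * c] and travels at most [f w0 / eta + eta / (2 * c)] for every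
    [eta > 0] ([gap_decay], [flow_displacement]). As [f w0] is [L 0 / alpha ^+ 2],
    the parameter [eta] and then a lower bound on [alpha] can be chosen so that
    this distance is smaller than the radius of the ball. The flow therefore never
    leaves the ball ([flow_stays]), converges at the rate [c] and ends at a point
    of the open ball where [f] takes its infimum over the ball, that is, at a
    local minimum. *)

Set Implicit Arguments.
Unset Strict Implicit.
Unset Printing Implicit Defensive.

Local Open Scope classical_set_scope.
Local Open Scope ring_scope.

(** * Inner products *)

(** Stated for a bare symmetric form so that it serves the Euclidean product of
    [R^p] and the inner product of the Hilbert space alike. *)
Lemma symmetric_form_CS (R : realType) (V : lmodType R) (B : V -> V -> R) :
  (forall a x y z, B (a *: x + y) z = a * B x z + B y z) ->
  (forall x y, B x y = B y x) -> (forall x, 0 <= B x x) ->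
  forall x y, B x y ^+ 2 <= B x x * B y y.
Proof.
move=> Bl BC B0 x y.
have Br a u v z : B z (a *: u + v) = a * B z u + B z v.
  by rewrite BC Bl !(BC z).
(* The trailing 0 gives both terms the shape [a *: u + v] of linearity. *)
have E s t : B (s *: x + (t *: y + 0)) (s *: x + (t *: y + 0)) =
    s ^+ 2 * B x x + 2 * s * t * B x y + t ^+ 2 * B y y.
  have H0 z : B z 0 = 0.
    by have := Br 1 0 0 z; rewrite scaler0 addr0 mul1r; lra.
  have H0l z : B 0 z = 0 by rewrite BC.
  rewrite !(Bl, Br) !H0 !H0l (BC y x); ring.
have [y0|yn0] := eqVneq (B y y) 0.
  rewrite y0 mulr0.
  have [->|xyn0] := eqVneq (B x y) 0; first by rewrite expr0n.
  (* As B y y = 0, the form is affine in the coefficient of y, and this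
     coefficient brings it down to - B x x - 2. *)
  have := B0 (1 *: x + ((- (B x x + 1) / (2 * B x y)) *: y + 0)).
  rewrite E y0 mulr0 addr0 expr1n mul1r mulr1.
  have -> : 2 * (- (B x x + 1) / (2 * B x y)) * B x y = - (B x x + 1).
    by field.
  lra.
have yp : 0 < B y y by rewrite lt_neqAle eq_sym yn0 B0.
have := B0 (B y y *: x + ((- B x y) *: y + 0)).
rewrite E.
have -> : B y y ^+ 2 * B x x + 2 * B y y * - B x y * B x y +
   (- B x y) ^+ 2 * B y y = B y y * (B x x * B y y - B x y ^+ 2) by ring.
by rewrite pmulr_rge0// subr_ge0.
Qed.

Lemma edotE (R : realType) (p : nat) (u v : 'rV[R]_p) :
  edot u v = \sum_i u 0 i * v 0 i.
Proof. by rewrite /edot mxE; apply: eq_bigr => i _; rewrite mxE. Qed.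

Lemma edotC (R : realType) (p : nat) (u v : 'rV[R]_p) : edot u v = edot v u.
Proof. by rewrite !edotE; apply: eq_bigr => i _; rewrite mulrC. Qed.

Lemma edot_linearl (R : realType) (p : nat) (a : R) (u v z : 'rV[R]_p) :
  edot (a *: u + v) z = a * edot u z + edot v z.
Proof. by rewrite /edot mulmxDl -scalemxAl !mxE. Qed.

Lemma edot_linearr (R : realType) (p : nat) (a : R) (u v z : 'rV[R]_p) :
  edot z (a *: u + v) = a * edot z u + edot z v.
Proof. by rewrite edotC edot_linearl !(edotC z). Qed.

Lemma edot_ge0 (R : realType) (p : nat) (u : 'rV[R]_p) : 0 <= edot u u.
Proof. by rewrite edotE; apply: sumr_ge0 => i _; rewrite -expr2 sqr_ge0. Qed.

Lemma enorm_ge0 (R : realType) (p : nat) (u : 'rV[R]_p) : 0 <= enorm u.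
Proof. exact: sqrtr_ge0. Qed.

Lemma enorm_sqr (R : realType) (p : nat) (u : 'rV[R]_p) :
  enorm u ^+ 2 = edot u u.
Proof. by rewrite sqr_sqrtr// edot_ge0. Qed.

Lemma edot_le (R : realType) (p : nat) (u v : 'rV[R]_p) :
  edot u v <= enorm u * enorm v.
Proof.
rewrite (le_trans (ler_norm _))// -ler_sqr ?nnegrE ?mulr_ge0 ?enorm_ge0//.
rewrite exprMn !enorm_sqr -normrX ger0_norm ?sqr_ge0//.
apply: symmetric_form_CS; [exact: edot_linearl|exact: edotC|exact: edot_ge0].
Qed.

Lemma enormZ (R : realType) (p : nat) (a : R) (u : 'rV[R]_p) :
  enorm (a *: u) = `|a| * enorm u.
Proof.
rewrite /enorm -sqrtr_sqr -sqrtrM ?sqr_ge0//; congr Num.sqrt.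
by rewrite !edotE mulr_sumr; apply: eq_bigr => i _; rewrite !mxE; ring.
Qed.

Lemma enormB (R : realType) (p : nat) (u v : 'rV[R]_p) :
  enorm (u - v) = enorm (v - u).
Proof. by rewrite -opprB -scaleN1r enormZ normrN1 mul1r. Qed.

Lemma norm_coord_le (R : realType) (p : nat) (u : 'rV[R]_p) i : `|u 0 i| <= `|u|.
Proof.
rewrite [leRHS]mx_normrE.
exact: (@le_bigmax _ _ _ _ (fun j : 'I_1 * 'I_p => `|u j.1 j.2|) (0, i)).
Qed.

Lemma norm_le_coord (R : realType) (p : nat) (u : 'rV[R]_p) M :
  0 <= M -> (forall i, `|u 0 i| <= M) -> `|u| <= M.
Proof.
move=> M0 uM; rewrite [leLHS]mx_normrE; apply/bigmax_leP; split=> //.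
by move=> [i j] _ /=; rewrite ord1.
Qed.

Lemma norm_le_enorm (R : realType) (p : nat) (u : 'rV[R]_p) : `|u| <= enorm u.
Proof.
apply: norm_le_coord => [|i]; first exact: enorm_ge0.
rewrite -sqrtr_sqr ler_wsqrtr// edotE (bigD1 i)//= -expr2 lerDl.
by apply: sumr_ge0 => j _; rewrite -expr2 sqr_ge0.
Qed.

Lemma enorm_le_norm (R : realType) (p : nat) (u : 'rV[R]_p) :
  enorm u <= p.+1%:R * `|u|.
Proof.
rewrite -(ger0_norm (enorm_ge0 u)) -ler_sqr ?nnegrE// ger0_norm ?enorm_ge0//.
rewrite enorm_sqr exprMn edotE.
apply: (@le_trans _ _ (\sum_(i < p) `|u| ^+ 2)).
  apply: ler_sum => i _; rewrite -expr2 -real_normK ?num_real//.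
  by rewrite ler_sqr ?nnegrE// norm_coord_le.
rewrite sumr_const card_ord -[_ *+ p]mulr_natl ler_wpM2r ?sqr_ge0//.
by rewrite -natrX ler_nat (leq_trans (leqnSn _))// leq_pmulr.
Qed.

Lemma enormD (R : realType) (p : nat) (u v : 'rV[R]_p) :
  enorm (u + v) <= enorm u + enorm v.
Proof.
rewrite -ler_sqr ?nnegrE ?addr_ge0 ?enorm_ge0//.
rewrite enorm_sqr -[u]scale1r edot_linearl -[v]scale1r !(edot_linearr 1) !scale1r.
rewrite (edotC v u) -!enorm_sqr.
by have := edot_le u v; lra.
Qed.

Lemma edotZl (R : realType) (p : nat) (a : R) (u v : 'rV[R]_p) :
  edot (a *: u) v = a * edot u v.
Proof. by rewrite /edot -scalemxAl mxE. Qed.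

Lemma edotBr (R : realType) (p : nat) (u v z : 'rV[R]_p) :
  edot z (u - v) = edot z u - edot z v.
Proof. by rewrite /edot linearB/= mulmxBr !mxE. Qed.

Section InnerProduct.
Variables (R : realType) (F : completeNormedModType R) (dotF : {dot F for idfun}).
Hypothesis dotF_norm : forall v : F, `|v| ^+ 2 = dotF v v.

Lemma dotFC x y : dotF x y = dotF y x.
Proof. by rewrite hermC expr0 mul1r. Qed.

Lemma dotF_CS x y : `|dotF x y| <= `|x| * `|y|.
Proof.
rewrite -ler_sqr ?nnegrE ?mulr_ge0// exprMn !dotF_norm -normrX.
rewrite ger0_norm ?sqr_ge0//.
apply: (@symmetric_form_CS _ F (fun x y => dotF x y)) => //.
- by move=> a u v z; rewrite linearDl linearZl_LR.
- exact: dotFC.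
- by move=> u; rewrite -dotF_norm sqr_ge0.
Qed.

End InnerProduct.

(** * Mean value inequality and strong convexity *)

Section Lines.
Variable R : realType.

Lemma is_derive_line (V W : normedModType R) (h : V -> W) (x d : V) (s : R) :
  differentiable h (x + s *: d) ->
  is_derive s (1 : R) (fun s => h (x + s *: d)) ('d h (x + s *: d) d).
Proof.
move=> dh; have dd := @diff_derivable _ _ _ h _ d dh.
have E : (fun k : R => k^-1 *: (((fun s => h (x + s *: d)) \o shift s) (k *: 1)
      - h (x + s *: d))) =
   (fun k : R => k^-1 *: ((h \o shift (x + s *: d)) (k *: d) - h (x + s *: d))).
  apply/funext => k /=; congr (_ *: (h _ - _)).
  by rewrite [k%:A](mulr1 k) scalerDl addrCA.
split; first by rewrite /derivable E.
by rewrite -deriveE// /derive E.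
Qed.

Lemma is_derive_linear (V W : normedModType R) (l : {linear V -> W})
    (g : R -> V) (s : R) (dg : V) :
  continuous l -> is_derive s (1 : R) g dg ->
  is_derive s (1 : R) (fun s => l (g s)) (l dg).
Proof.
move=> lc [dg1 dg2].
have E : (fun k : R => k^-1 *: (((fun s => l (g s)) \o shift s) (k *: 1)
      - l (g s))) =
   l \o (fun k : R => k^-1 *: ((g \o shift s) (k *: 1) - g s)).
  by apply/funext => k /=; rewrite [RHS]linearZ/= [in RHS]linearB.
have C : l \o (fun k : R => k^-1 *: ((g \o shift s) (k *: 1) - g s)) @ 0^' --> l dg.
  apply: continuous_cvg; first exact: lc.
  by rewrite -dg2; exact: dg1.
split; first by rewrite /derivable E; apply/cvg_ex; exists (l dg).
by rewrite /derive E; apply: cvg_lim.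
Qed.

End Lines.

Section MeanValue.
Variables (R : realType) (F : completeNormedModType R) (dotF : {dot F for idfun}).
Hypothesis dotF_norm : forall v : F, `|v| ^+ 2 = dotF v v.

Lemma dotF_continuous (u : F) : continuous (dotF u).
Proof.
apply: bounded_linear_continuous; apply/bounded_funP => r.
exists (`|u| * r) => x xr.
by rewrite (le_trans (dotF_CS dotF_norm _ _))// ler_wpM2l.
Qed.

(** Pairing with the error vector itself reduces the vector-valued inequality
    to the mean value theorem for one real function. *)
Lemma mean_value_le (V : normedModType R) (h : V -> F) (T : {linear V -> F})
    (x y : V) (M : R) :
  (forall w, differentiable h w) ->
  (forall s, 0 <= s <= 1 ->
    `|'d h (y + s *: (x - y)) (x - y) - T (x - y)| <= M) ->
  `|h x - h y - T (x - y)| <= M.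
Proof.
move=> dh hM; set u := h x - h y - T (x - y).
pose f (s : R) : R := dotF u (h (y + s *: (x - y))) - dotF u (T (x - y)) * s.
pose df (s : R) := dotF u ('d h (y + s *: (x - y)) (x - y) - T (x - y)).
have fd (s : R) : is_derive s (1 : R) f (df s).
  have H1 : is_derive s (1 : R) (fun s => dotF u (h (y + s *: (x - y))))
      (dotF u ('d h (y + s *: (x - y)) (x - y))).
    apply: (@is_derive_linear R F R (dotF u)); first exact: dotF_continuous.
    exact: is_derive_line.
  have H2 : is_derive s (1 : R) (dotF u (T (x - y)) *: @id R)
      (dotF u (T (x - y)) *: (1 : R)).
    exact: is_deriveZ.
  have -> : df s = dotF u ('d h (y + s *: (x - y)) (x - y)) -
      dotF u (T (x - y)) *: (1 : R).
    by rewrite /df linearBr /GRing.scale/= mulr1.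
  exact: is_deriveB H1 H2.
have [c c01] : exists2 c : R, c \in `]0, 1[ & f 1 - f 0 = df c * (1 - 0).
  apply: MVT => //; apply: continuous_subspaceT => z.
  by apply: differentiable_continuous; apply/derivable1_diffP.
have -> : f 1 - f 0 = dotF u u.
  rewrite /f /u !linearBr /= scale0r addr0 scale1r (addrC y) subrK; ring.
rewrite subr0 mulr1 -dotF_norm => uu.
have [->|un0] := eqVneq u 0.
  by rewrite normr0; apply: le_trans (hM 0 _); rewrite // lexx ler01.
rewrite -(@ler_pM2l _ `|u|) ?normr_gt0// -expr2 uu.
apply: le_trans (ler_norm _) _; apply: le_trans (dotF_CS dotF_norm _ _) _.
rewrite ler_wpM2l//; apply: hM.
by move: c01; rewrite in_itv/= => /andP[/ltW -> /ltW ->].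
Qed.

(** Dividing the convexity inequality on the segment from [x] to [y] by the
    parameter [k] and letting [k] tend to 0 from the right produces the
    differential of [L] at [x]. *)
Lemma strongly_convex_above_tangent (L : F -> R^o) (G : F -> F) (mu : R) :
  (forall x, is_gradient dotF L x (G x)) ->
  (forall (x y : F) (t : R), 0 <= t <= 1 ->
      L (t *: x + (1 - t) *: y) <=
        t * L x + (1 - t) * L y - mu / 2 * t * (1 - t) * `|x - y| ^+ 2) ->
  forall x y, L x + dotF (G x) (y - x) + mu / 2 * `|y - x| ^+ 2 <= L y.
Proof.
move=> LG Lc x y; have [Ld dL] := LG x.
set d := y - x; apply/ler_addgt0Pr => e e0.
have C : (fun k : R => k^-1 *: ((L \o shift x) (k *: d) - L x)) @ 0^' -->
    dotF (G x) d.
  rewrite -dL -deriveE//; exact: diff_derivable.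
have {}C : \forall k \near (0 : R)^'+,
    `|dotF (G x) d - k^-1 *: ((L \o shift x) (k *: d) - L x)| < e / 2.
  have /cvgrPdist_lt /(_ (e / 2)) := C; rewrite divr_gt0// => /(_ isT).
  rewrite !near_withinE; apply: filterS => k Hk k0.
  by apply: Hk; rewrite gt_eqF.
pose m := mu / 2 * `|d| ^+ 2.
near (0 : R)^'+ => k.
have k0 : 0 < k by near: k; exact: nbhs_right_gt.
have k1 : k < 1 by near: k; exact: nbhs_right_lt.
have km : k < e / 2 / (`|m| + 1).
  by near: k; apply: nbhs_right_lt; rewrite !divr_gt0// ltr_wpDl.
have k2 : `|dotF (G x) d - k^-1 *: ((L \o shift x) (k *: d) - L x)| < e / 2.
  by near: k.
have := Lc y x k; rewrite (ltW k0) (ltW k1) => /(_ isT).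
have -> : k *: y + (1 - k) *: x = k *: d + x.
  by rewrite /d scalerBr scalerBl scale1r -addrA [- _ + x]addrC.
move: k2; rewrite /= ltr_norml => /andP[_].
set q := _ *: _; set A := L (k *: d + x).
have -> : A = L x + k * q.
  by rewrite /q /GRing.scale/= mulrA divff ?gt_eqF// mul1r /A; ring.
rewrite -/d -/m => k2.
have -> : mu / 2 * k * (1 - k) * `|d| ^+ 2 = k * (1 - k) * m by rewrite /m; ring.
move=> H.
have : q <= L y - L x - (1 - k) * m.
  rewrite -(ler_pM2l k0) -subr_ge0.
  by move: H; rewrite -subr_ge0; congr (_ <= _); ring.
have : k * m <= e / 2.
  rewrite (le_trans (ler_norm _))// normrM (gtr0_norm k0).
  move: km; rewrite ltr_pdivlMr ?ltr_wpDl// => /ltW; apply: le_trans.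
  by rewrite ler_wpM2l ?(ltW k0)// lerDl.
have -> : (1 - k) * m = m - k * m by ring.
move: k2; set km' := k * m; lra.
Unshelve. all: by end_near. Qed.

End MeanValue.

(** * Linear maps between R^p and the Hilbert space *)

Section LinearMaps.
Variable R : realType.

Lemma linear_rV_bounded (p : nat) (V : normedModType R)
    (f : {linear 'rV[R]_p -> V}) :
  exists2 M : R, 0 < M & forall v, `|f v| <= M * `|v|.
Proof.
exists (1 + \sum_(i < p) `|f (delta_mx 0 i)|) => [|v].
  by rewrite ltr_wpDr// sumr_ge0.
rewrite mulrDl mul1r ler_wpDl// mulr_suml {1}(row_sum_delta v) linear_sum.
apply: le_trans (ler_norm_sum _ _ _) _; apply: ler_sum => i _.
by rewrite linearZ/= normrZ mulrC ler_wpM2l// norm_coord_le.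
Qed.

(** A supremum dominates its set only when the set is bounded above, hence the
    appeal to the boundedness of linear maps on [R^p]. *)
Lemma opnorm_bound (p : nat) (V : normedModType R)
    (f : {linear 'rV[R]_p -> V}) v : `|f v| <= opnorm f * enorm v.
Proof.
have [M M0 fM] := linear_rV_bounded f.
have [->|vn0] := eqVneq v 0.
  by rewrite linear0 normr0 /enorm edotE big1 ?sqrtr0 ?mulr0// => i _; rewrite mxE mul0r.
have ev0 : 0 < enorm v by rewrite (lt_le_trans _ (norm_le_enorm v))// normr_gt0.
rewrite -ler_pdivrMr//.
have -> : `|f v| / enorm v = `|f ((enorm v)^-1 *: v)|.
  by rewrite linearZ normrZ normfV (gtr0_norm ev0) mulrC.
apply: ub_le_sup; last first.
  exists ((enorm v)^-1 *: v) => //=.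
  by rewrite enormZ normfV (gtr0_norm ev0) mulVf// gt_eqF.
exists M => _ [u /= u1 <-]; apply: le_trans (fM u) _.
by rewrite -[leRHS]mulr1 ler_pM2l// (le_trans (norm_le_enorm u)).
Qed.

(** The sup norm and the Euclidean norm of [R^p] differ by a factor at most
    [p.+1]. From here to the gradient inequality all estimates on [R^p] use the sup norm,
    which is the norm of the type ['rV[R]_p]. *)
Lemma locally_lipschitz_ball (p : nat) (V : normedModType R)
    (h : 'rV[R]_p -> V) (w0 : 'rV[R]_p) :
  locally_lipschitz_diff h ->
  exists k rho : R, [/\ 0 < k, 0 < rho & forall u v x,
    `|u - w0| < rho -> `|v - w0| < rho ->
    `|'d h u x - 'd h v x| <= k * `|u - v| * `|x|].
Proof.
move=> /(_ w0) [k [U /nbhs_normP [rho /= rho0 Urho] kU]].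
exists ((`|k| + 1) * p.+1%:R * p.+1%:R), rho; split=> //.
move=> u v x uw vw.
have := opnorm_bound ('d h u \- 'd h v) x; move=> /le_trans; apply.
have Uu : U u by apply: Urho; rewrite /= distrC.
have Uv : U v by apply: Urho; rewrite /= distrC.
have := kU u v Uu Uv => H.
apply: (@le_trans _ _ ((`|k| + 1) * enorm (u - v) * enorm x)).
  rewrite ler_wpM2r ?enorm_ge0// (le_trans H)// ler_wpM2r ?enorm_ge0//.
  by rewrite (le_trans (ler_norm k))// lerDl.
have E u' := enorm_le_norm (u' : 'rV[R]_p).
have -> : (`|k| + 1) * p.+1%:R * p.+1%:R * `|u - v| * `|x| =
  (`|k| + 1) * (p.+1%:R * `|u - v|) * (p.+1%:R * `|x|) by ring.
apply: ler_pM; rewrite ?mulr_ge0 ?addr_ge0 ?enorm_ge0//.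
by rewrite ler_wpM2l// addr_ge0.
Qed.

End LinearMaps.

Section Rank.
Variables (R : realType) (F : completeNormedModType R) (dotF : {dot F for idfun}).
Hypothesis dotF_norm : forall v : F, `|v| ^+ 2 = dotF v v.

(** The Gram matrix of a basis of the range is invertible, hence the orthogonal
    projection onto the range has coordinates that a bounded linear map
    computes. *)
Lemma has_rank_left_inverse (p r : nat) (A : {linear 'rV[R]_p -> F}) :
  has_rank A r ->
  exists (e : 'M[R]_(r, p)) (Q : {linear F -> 'rV[R]_r}) (q : R),
    [/\ 0 < q, forall y, `|Q y| <= q * `|y| & forall c, Q (A (c *m e)) = c].
Proof.
move=> [b [bfree brange]].
have /choice [e Ae] : forall i, exists x, A x = b i.
  move=> i; have : range A (b i).
    rewrite brange; exists (fun j => (i == j)%:R) => //.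
    by rewrite (bigD1 i)//= eqxx scale1r big1 ?addr0// => j /negPf ji;
      rewrite eq_sym ji scale0r.
  by case=> x _ <-; exists x.
pose E : 'M[R]_(r, p) := \matrix_i e i.
have AE (c : 'rV[R]_r) : A (c *m E) = \sum_i c 0 i *: b i.
  rewrite mulmx_sum_row linear_sum; apply: eq_bigr => i _.
  by rewrite linearZ/= rowK Ae.
pose Gram : 'M[R]_r := \matrix_(i, j) dotF (b i) (b j).
pose P (y : F) : 'rV[R]_r := \row_j dotF y (b j).
have PA (c : 'rV[R]_r) : P (A (c *m E)) = c *m Gram.
  apply/rowP => j; rewrite !mxE AE dotFC linear_sum; apply: eq_bigr => i _.
  by rewrite linearZ/= mxE dotFC.
have Gu : Gram \in unitmx.
  rewrite -row_free_unit -kermx_eq0; apply/eqP/row_matrixP => k.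
  rewrite row0; set c := row k _.
  have cG : c *m Gram = 0.
    by apply/eqP; rewrite /c -row_mul mulmx_ker row0.
  have c0 : \sum_i c 0 i *: b i = 0.
    apply/eqP; rewrite -normr_eq0 -sqrf_eq0 dotF_norm -AE.
    rewrite {2}AE linear_sum big1// => j _.
    rewrite linearZ/=.
    have -> : dotF (A (c *m E)) (b j) = P (A (c *m E)) 0 j by rewrite mxE.
    by rewrite PA cG [X in _ * X]mxE mulr0.
  by apply/rowP => j; rewrite [RHS]mxE; exact: bfree c0 j.
have Ql : linear (fun y : F => P y *m invmx Gram).
  move=> a x y; rewrite scalemxAl -mulmxDl; congr (_ *m _).
  by apply/rowP => j; rewrite !mxE linearPl.
pose Q : {linear F -> 'rV[R]_r} :=
  HB.pack (fun y : F => P y *m invmx Gram) (GRing.isLinear.Build _ _ _ _ _ Ql).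
have PB y : `|P y| <= (\sum_i `|b i|) * `|y|.
  apply: norm_le_coord => [|i]; first by rewrite mulr_ge0// sumr_ge0.
  rewrite mxE; apply: le_trans (dotF_CS dotF_norm _ _) _.
  rewrite mulrC ler_wpM2r// (bigD1 i)//= lerDl sumr_ge0//.
have [M M0 HM] := linear_rV_bounded (mulmxr (invmx Gram) : {linear 'rV[R]_r -> 'rV[R]_r}).
exists E, Q, (M * (\sum_i `|b i| + 1)); split.
- by rewrite mulr_gt0// ltr_wpDl// sumr_ge0.
- move=> y; apply: le_trans (HM (P y)) _.
  rewrite -mulrA ler_wpM2l ?(ltW M0)// (le_trans (PB y))//.
  by rewrite ler_wpM2r// lerDl.
- by move=> c; rewrite /Q/= PA mulmxK.
Qed.

(** The images of the [r] rows of [e] are independent and lie in the span of [r]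
    vectors, so their matrix of coordinates is invertible and they span the whole
    range. *)
Lemma has_rank_range (p r : nat) (A : {linear 'rV[R]_p -> F}) (e : 'M[R]_(r, p)) :
  has_rank A r -> (forall c : 'rV[R]_r, A (c *m e) = 0 -> c = 0) ->
  forall x, exists c : 'rV[R]_r, A x = A (c *m e).
Proof.
move=> [b [bfree brange]] inj x.
have inb y : exists c : 'I_r -> R, A y = \sum_i c i *: b i.
  have : range A (A y) by exists y.
  by rewrite brange => -[c _ <-]; exists c.
have /choice [m Am] : forall i, exists c, A (row i e) = \sum_j c j *: b j.
  by move=> i; exact: inb.
pose M : 'M[R]_r := \matrix_(i, j) m i j.
have AM (c : 'rV[R]_r) : A (c *m e) = \sum_j (c *m M) 0 j *: b j.
  rewrite mulmx_sum_row linear_sum.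
  under eq_bigr => i _ do rewrite linearZ/= Am scaler_sumr.
  rewrite exchange_big/=; apply: eq_bigr => j _.
  by rewrite mxE scaler_suml; apply: eq_bigr => i _; rewrite mxE scalerA.
have Mu : M \in unitmx.
  rewrite -row_free_unit -kermx_eq0; apply/eqP/row_matrixP => k.
  rewrite row0; apply: inj; rewrite AM -row_mul mulmx_ker.
  by rewrite big1// => j _; rewrite !mxE scale0r.
have [c ->] := inb x.
exists ((\row_i c i) *m invmx M); rewrite AM mulmxKV//.
by apply: eq_bigr => i _; rewrite mxE.
Qed.

End Rank.

(** * Fibres of a map of constant rank *)

Section Tools.
Variable R : realType.

Lemma segment_ball (V : normedModType R) (w0 u v : V) (s rho : R) :
  0 <= s <= 1 -> `|u - w0| < rho -> `|v - w0| < rho ->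
  `|v + s *: (u - v) - w0| < rho.
Proof.
move=> /andP[s0 s1] uw vw.
have -> : v + s *: (u - v) - w0 = s *: (u - w0) + (1 - s) *: (v - w0).
  have -> : u - v = (u - w0) - (v - w0) by rewrite opprB addrA subrK.
  by rewrite addrAC scalerBl scale1r (scalerBr s (u - w0)) addrCA.
apply: le_lt_trans (ler_normD _ _) _.
rewrite !normrZ (ger0_norm s0) ger0_norm ?subr_ge0//.
have [->|sn0] := eqVneq s 0; first by rewrite mul0r add0r subr0 mul1r.
have sp : 0 < s by rewrite lt_neqAle eq_sym sn0 s0.
have -> : rho = s * rho + (1 - s) * rho by ring.
by rewrite ltr_leD// ?ltr_pM2l// ler_wpM2l ?subr_ge0// ltW.
Qed.

Lemma ball_fixed_point (X : completeNormedModType R) (Phi : X -> X) (rho : R) :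
  0 <= rho -> `|Phi 0| <= rho / 2 ->
  (forall x y, `|x| <= rho -> `|y| <= rho ->
    `|Phi x - Phi y| <= 2^-1 * `|x - y|) ->
  exists2 x, `|x| <= rho & Phi x = x.
Proof.
move=> rho0 Phi0 PhiL; pose U := [set x : X | `|x| <= rho].
have PhiU : set_fun U U Phi.
  rewrite /U => x /= xr; rewrite -[Phi x](subrK (Phi 0)).
  apply: le_trans (ler_normD _ _) _.
  have := PhiL x 0 xr; rewrite normr0 subr0 => /(_ rho0).
  move: Phi0 xr; lra.
have [] := @banach_fixed_point R X U (mkfun PhiU).
- exists (2^-1)%:nng; split => /=; first by rewrite invf_lt1// ltr1n.
  by move=> [x y] /= [xU yU]; exact: PhiL.
- have -> : U = closed_ball_ (fun x => `|x|) 0 rho.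
    by apply/seteqP; split=> x; rewrite /U/closed_ball_/= sub0r normrN.
  exact: closed_closed_ball_.
- by exists 0; rewrite /U/= normr0.
by move=> x xU xE; exists x => //; rewrite [RHS]xE.
Qed.

(** Subdividing [0, 1] into [n] equal steps bounds [f 1 - f 0] by
    [n * (K / n ^ 2) = K / n]. *)
Lemma quadratic_modulus_constant (V : normedModType R) (f : R -> V) (K : R) :
  (forall s t, 0 <= s <= 1 -> 0 <= t <= 1 -> `|f s - f t| <= K * (s - t) ^+ 2) ->
  f 1 = f 0.
Proof.
move=> fK; apply/eqP; rewrite -subr_eq0 -normr_le0; apply/ler_addgt0Pr => e e0.
rewrite add0r.
have H n : `|f 1 - f 0| <= K / n.+1%:R.
  pose g i := f (i%:R / n.+1%:R).
  have -> : f 1 - f 0 = \sum_(0 <= i < n.+1) (g i.+1 - g i).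
    by rewrite telescope_sumr// /g mul0r divff.
  rewrite big_mkord; apply: le_trans (ler_norm_sum _ _ _) _.
  apply: (@le_trans _ _ (\sum_(i < n.+1) K / n.+1%:R ^+ 2)).
    apply: ler_sum => i _; rewrite /g.
    apply: le_trans (fK _ _ _ _) _.
    - by rewrite divr_ge0//= ler_pdivrMr// mul1r ler_nat.
    - by rewrite divr_ge0//= ler_pdivrMr// mul1r ler_nat ltnW.
    by rewrite -mulrBl -natrB// subSnn mul1r exprVn.
  rewrite sumr_const card_ord -[_ *+ n.+1]mulr_natl.
  have : (n.+1%:R : R) != 0 by [].
  by move: (n.+1%:R : R) => N N0; rewrite le_eqVlt; apply/orP; left; apply/eqP; field.
apply: le_trans (H (Num.Def.trunc (K / e))) _.
by rewrite ler_pdivrMr// mulrC -ler_pdivrMr// ltW// truncnS_gt.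
Qed.

End Tools.

Section Fibres.
Variables (R : realType) (F : completeNormedModType R) (dotF : {dot F for idfun}).
Hypothesis dotF_norm : forall v : F, `|v| ^+ 2 = dotF v v.
Variables (p : nat) (h : 'rV[R]_p -> F).
Hypothesis h_diff : forall w : 'rV[R]_p, differentiable h w.

Variables (w0 : 'rV[R]_p) (k rho : R).
Hypotheses (k0 : 0 < k) (rho0 : 0 < rho).
Hypothesis Dh_lip : forall u v x : 'rV[R]_p, `|u - w0| < rho -> `|v - w0| < rho ->
  `|'d h u x - 'd h v x| <= k * `|u - v| * `|x|.

(** The constant is not optimal: the Lipschitz bound is used at the worst point
    of the segment rather than integrated along it. *)
Lemma taylor_quadratic (u v : 'rV[R]_p) : `|u - w0| < rho -> `|v - w0| < rho ->
  `|h u - h v - 'd h v (u - v)| <= k * `|u - v| ^+ 2.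
Proof.
move=> uw vw; apply: (mean_value_le dotF_norm) => // s s01.
apply: le_trans (Dh_lip _ _ _) _ => //; first exact: segment_ball.
rewrite expr2 mulrA ler_wpM2r// ler_wpM2l ?(ltW k0)//.
rewrite [_ + s *: _]addrC addrK normrZ ler_piMl//.
by have /andP[s0 s1] := s01; rewrite ger0_norm.
Qed.

Lemma taylor_center (d : R) (u v : 'rV[R]_p) : d <= rho -> `|u - w0| < d -> `|v - w0| < d ->
  `|h u - h v - 'd h w0 (u - v)| <= k * d * `|u - v|.
Proof.
move=> dr uw vw; apply: (mean_value_le dotF_norm) => // s s01.
have Z := segment_ball s01 uw vw.
apply: le_trans (Dh_lip _ _ _) _ => //.
- exact: lt_le_trans dr.
- by rewrite subrr normr0.
by rewrite ler_wpM2r// ler_wpM2l ?(ltW k0)// ltW.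
Qed.

Variables (r : nat) (e : 'M[R]_(r, p)) (Q : {linear F -> 'rV[R]_r}).
Variables (q l M d : R).
Hypotheses (q0 : 0 < q) (l0 : 0 < l) (M0 : 0 < M) (d0 : 0 < d).
Hypothesis Q_le : forall y, `|Q y| <= q * `|y|.
Hypothesis QA : forall c, Q ('d h w0 (c *m e)) = c.
Hypothesis e_le : forall c : 'rV[R]_r, `|c *m e| <= l * `|c|.
Hypothesis d_rho : d <= rho.
Hypothesis d_small : q * k * d * l <= 2^-1.
Hypothesis Dh_le : forall w x : 'rV[R]_p, `|w - w0| < d -> `|'d h w x| <= M * `|x|.
Hypothesis Dh_rank : forall w : 'rV[R]_p, `|w - w0| < d -> has_rank ('d h w) r.

Lemma h_lipschitz (u v : 'rV[R]_p) : `|u - w0| < d -> `|v - w0| < d ->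
  `|h u - h v| <= M * `|u - v|.
Proof.
move=> uw vw.
have := @mean_value_le _ _ _ dotF_norm _ h (\0 : {linear 'rV[R]_p -> F}) u v
  (M * `|u - v|) h_diff.
rewrite /= subr0; apply => s s01; rewrite subr0; apply: Dh_le.
exact: segment_ball.
Qed.

(** [c *m e] parametrizes a complement of the kernel of ['d h w0] and [Q] inverts
    ['d h w0] there. Near [w0] the differential of [h] has moved by at most
    [k * d], which [d_small] makes small against the norms of [Q] and [e]. *)
Lemma slice_near_identity (a : 'rV[R]_p) (c c' : 'rV[R]_r) :
  `|a + c *m e - w0| < d -> `|a + c' *m e - w0| < d ->
  `|c - c' - Q (h (a + c *m e) - h (a + c' *m e))| <= 2^-1 * `|c - c'|.
Proof.
move=> cd c'd; have := taylor_center d_rho cd c'd.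
have -> : a + c *m e - (a + c' *m e) = (c - c') *m e.
  by rewrite mulmxBl opprD addrACA subrr add0r.
move=> H; rewrite -{1}(QA (c - c')) -linearB/= -normrN -linearN opprB.
apply: le_trans (Q_le _) _.
apply: (@le_trans _ _ (q * (k * d * (l * `|c - c'|)))).
  rewrite ler_wpM2l ?(ltW q0)// (le_trans H)// ler_wpM2l//.
  by rewrite mulr_ge0 ?ltW.
have -> : q * (k * d * (l * `|c - c'|)) = q * k * d * l * `|c - c'| by ring.
by rewrite ler_wpM2r.
Qed.

Lemma slice_injective (a : 'rV[R]_p) (c c' : 'rV[R]_r) :
  `|a + c *m e - w0| < d -> `|a + c' *m e - w0| < d ->
  `|c - c'| <= 2 * `|Q (h (a + c *m e) - h (a + c' *m e))|.
Proof.
move=> cd c'd; have := slice_near_identity cd c'd.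
set X := Q _ => H.
have : `|c - c'| <= `|c - c' - X| + `|X|.
  by rewrite -{1}(subrK X (c - c')); exact: ler_normD.
lra.
Qed.

(** Constancy of the rank enters here only. [Q] stays injective on the image of the
    slice under ['d h a], which has dimension [r]; the rank at [a] being [r] too,
    this image is the whole range of ['d h a]. *)
Lemma Q_detects_range (a x : 'rV[R]_p) : `|a - w0| < d ->
  `|'d h a x| <= 2 * M * l * `|Q ('d h a x)|.
Proof.
move=> ad.
have Qi (c : 'rV[R]_r) : `|c| <= 2 * `|Q ('d h a (c *m e))|.
  have : `|c - Q ('d h a (c *m e))| <= 2^-1 * `|c|.
    rewrite -{1}(QA c) -linearB/=; apply: le_trans (Q_le _) _.
    apply: (@le_trans _ _ (q * (k * d * (l * `|c|)))).
      rewrite ler_wpM2l ?(ltW q0)//.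
      apply: le_trans (Dh_lip _ _ _) _ => //; first by rewrite subrr normr0.
        exact: lt_le_trans d_rho.
      apply: ler_pM => //; first by rewrite mulr_ge0// ltW.
      by rewrite ler_wpM2l ?(ltW k0)// distrC ltW.
    have -> : q * (k * d * (l * `|c|)) = q * k * d * l * `|c| by ring.
    by rewrite ler_wpM2r.
  set X := Q _ => H.
  have : `|c| <= `|c - X| + `|X|.
    by rewrite -{1}(subrK X c); exact: ler_normD.
  lra.
have [c Ac] : exists c : 'rV[R]_r, 'd h a x = 'd h a (c *m e).
  apply: (has_rank_range (Dh_rank ad)) => c Ac0.
  apply/eqP; rewrite -normr_le0; apply: le_trans (Qi c) _.
  by rewrite Ac0 linear0 normr0 mulr0.
rewrite Ac; apply: le_trans (Dh_le _ ad) _.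
have -> : 2 * M * l * `|Q ('d h a (c *m e))| =
  M * (l * (2 * `|Q ('d h a (c *m e))|)) by ring.
rewrite ler_wpM2l ?(ltW M0)// (le_trans (e_le c))//.
by rewrite ler_wpM2l ?(ltW l0).
Qed.

(** A solution is a fixed point of [c |-> c - Q (h (a + c *m e)) + y], which
    halves distances by [slice_near_identity]. *)
Lemma slice_surjective (a : 'rV[R]_p) (y : 'rV[R]_r) : `|a - w0| < d / 4 ->
  `|y - Q (h a)| <= d / (2 * l) / 2 ->
  exists c : 'rV[R]_r, `|c| <= d / (2 * l) /\ Q (h (a + c *m e)) = y.
Proof.
move=> ad ya.
have sd (c : 'rV[R]_r) : `|c| <= d / (2 * l) -> `|a + c *m e - w0| < d.
  move=> cd; rewrite addrAC; apply: le_lt_trans (ler_normD _ _) _.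
  have : `|c *m e| <= d / 2.
    apply: le_trans (e_le c) _.
    have -> : d / 2 = l * (d / (2 * l)) by field; rewrite gt_eqF.
    by rewrite ler_wpM2l// ltW.
  by move: ad d0; lra.
pose X := HB.pack_for (completeNormedModType R) 'rV[R]_r
  (Complete.on 'rV[R]_r) (NormedModule.on 'rV[R]_r).
have [||c c' cd c'd|c cd cE] := @ball_fixed_point R X
    (fun c : 'rV[R]_r => c - Q (h (a + c *m e)) + y) (d / (2 * l)).
- by rewrite divr_ge0 ?mulr_ge0// ltW.
- by rewrite mul0mx addr0 sub0r addrC.
- have := slice_near_identity (sd _ cd) (sd _ c'd).
  have E (b b' g g' z : 'rV[R]_r) : b - b' - (g - g') = b - g + z - (b' - g' + z).
    by apply/rowP => i; rewrite !mxE; ring.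
  by rewrite linearB/= (E _ _ _ _ y).
exists c; split => //.
by move/eqP: cE; rewrite -addrA -subr_eq0 addrAC subrr add0r addrC subr_eq0 => /eqP.
Qed.

(** The points [v] and [w] may be far apart along a fibre of [h] while [h v] and
    [h w] are close, so [v] is first transported along its own fibre to a point
    [w + xi] of the slice through [w]. Along the segment from [v] to [w], correct
    each point [b s] within its slice to a point [a s] where [Q \o h] keeps the
    value that it has at [v]. As [Q] sees every direction in which [h] can move,
    [h (a s) - h (a t)] is of second order in [s - t], so [h \o a] is constant.
    In the slice through [w], [Q \o h] is injective with a Lipschitz inverse,
    and this controls [xi] by [h v - h w]. *)
Lemma fibre_correction (v w : 'rV[R]_p) :
  `|v - w0| < d / 4 -> `|w - w0| < d / 4 ->
  q * M * `|w - v| <= d / (2 * l) / 2 ->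
  exists xi, [/\ h (w + xi) = h v, `|xi| <= l * (2 * q) * `|h v - h w|
    & `|w + xi - w0| < d].
Proof.
move=> vd wd vw; pose b (s : R) := v + s *: (w - v).
have d4 : d / 4 < d by move: d0; lra.
have bd s : 0 <= s <= 1 -> `|b s - w0| < d / 4.
  by move=> s01; exact: segment_ball.
have bB s t : `|b s - b t| = `|s - t| * `|w - v|.
  by rewrite /b addrAC opprD addrA subrr add0r addrC -scalerBl normrZ.
have b0 : b 0 = v by rewrite /b scale0r addr0.
have Qh s t : 0 <= s <= 1 -> 0 <= t <= 1 ->
    `|Q (h (b s)) - Q (h (b t))| <= q * M * (`|s - t| * `|w - v|).
  move=> s01 t01; rewrite -linearB; apply: le_trans (Q_le _) _.
  rewrite -mulrA ler_wpM2l ?(ltW q0)// -bB; apply: h_lipschitz.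
    exact: lt_trans (bd _ s01) d4.
  exact: lt_trans (bd _ t01) d4.
have /choice [c cP] : forall s : R, exists cs : 'rV[R]_r, 0 <= s <= 1 ->
    `|cs| <= d / (2 * l) /\ Q (h (b s + cs *m e)) = Q (h v).
  move=> s.
  have [s01|s01] := boolP (0 <= s <= 1); last by exists 0.
  have [||cs csP] := @slice_surjective (b s) (Q (h v)); last by exists cs.
    exact: bd.
  rewrite -b0; apply: le_trans (Qh _ _ _ _) _ => //; first by rewrite lexx ?ler01.
  apply: le_trans vw; rewrite ler_wpM2l//; first by rewrite mulr_ge0// ltW.
  rewrite sub0r normrN.
  by rewrite ler_piMl//; have /andP[s0 s1] := s01; rewrite ger0_norm.
pose a s := b s + c s *m e.
have sd s t : 0 <= s <= 1 -> 0 <= t <= 1 -> `|b s + c t *m e - w0| < d.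
  move=> s01 t01; rewrite addrAC; apply: le_lt_trans (ler_normD _ _) _.
  have : `|c t *m e| <= d / 2.
    apply: le_trans (e_le _) _.
    have -> : d / 2 = l * (d / (2 * l)) by field; rewrite gt_eqF.
    by rewrite ler_wpM2l ?(ltW l0)//; have [] := cP t t01.
  by move: (bd s s01) d0; lra.
have cL s t : 0 <= s <= 1 -> 0 <= t <= 1 ->
    `|c s - c t| <= 2 * q * M * (`|s - t| * `|w - v|).
  move=> s01 t01; apply: le_trans (slice_injective (sd _ _ s01 s01) (sd _ _ s01 t01)) _.
  rewrite -2!mulrA ler_wpM2l// linearB/=.
  have [_ ->] := cP s s01; have [_ <-] := cP t t01.
  rewrite -linearB; apply: le_trans (Q_le _) _.
  rewrite ler_wpM2l ?(ltW q0)//; apply: le_trans (h_lipschitz _ _) _; try exact: sd.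
  by rewrite ler_wpM2l ?(ltW M0)// opprD addrACA subrr addr0 bB distrC.
pose N := `|w - v| + l * (2 * q * M * `|w - v|).
have aL s t : 0 <= s <= 1 -> 0 <= t <= 1 -> `|a s - a t| <= N * `|s - t|.
  move=> s01 t01; rewrite /a opprD addrACA -mulmxBl.
  apply: le_trans (ler_normD _ _) _; rewrite bB.
  have -> : N * `|s - t| = `|s - t| * `|w - v| +
      l * (2 * q * M * (`|s - t| * `|w - v|)) by rewrite /N; ring.
  rewrite lerD2l; apply: le_trans (e_le _) _.
  by rewrite ler_wpM2l ?(ltW l0)//; exact: cL.
have haL s t : 0 <= s <= 1 -> 0 <= t <= 1 ->
    `|h (a s) - h (a t)| <= ((2 * M * l * q + 1) * k * N ^+ 2) * (s - t) ^+ 2.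
  move=> s01 t01; have sr : d <= rho by [].
  have tq := taylor_quadratic (lt_le_trans (sd _ _ s01 s01) sr)
    (lt_le_trans (sd _ _ t01 t01) sr).
  rewrite -/(a s) -/(a t) in tq.
  set D := 'd h (a t) (a s - a t) in tq.
  have DQ : `|D| <= 2 * M * l * (q * (k * `|a s - a t| ^+ 2)).
    apply: le_trans (Q_detects_range _ (sd _ _ t01 t01)) _.
    rewrite ler_wpM2l//; first by rewrite !mulr_ge0// ltW.
    rewrite -/D.
    have -> : Q D = - Q (h (a s) - h (a t) - D).
      rewrite !linearB/=; have [_ ->] := cP s s01; have [_ ->] := cP t t01.
      by rewrite subrr sub0r opprK.
    rewrite normrN; apply: le_trans (Q_le _) _.
    by rewrite ler_wpM2l ?(ltW q0).
  have aa : `|a s - a t| ^+ 2 <= N ^+ 2 * (s - t) ^+ 2.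
    rewrite -(real_normK (num_real (s - t))) -exprMn ler_sqr ?nnegrE//.
      exact: aL.
    by rewrite mulr_ge0// /N addr_ge0// !mulr_ge0// ltW.
  rewrite -(subrK D (h (a s) - h (a t))); apply: le_trans (ler_normD _ _) _.
  apply: (@le_trans _ _ ((2 * M * l * q + 1) * k * `|a s - a t| ^+ 2)).
    by move: tq DQ; set X := `|a s - a t| ^+ 2; lra.
  rewrite -[leRHS]mulrA ler_wpM2l// mulr_ge0 ?ltW// addr_gt0//.
  by rewrite !mulr_gt0.
have ha01 := quadratic_modulus_constant haL.
have i0 : 0 <= (0 : R) <= 1 by apply/andP; split; [exact: lexx|exact: ler01].
have i1 : 0 <= (1 : R) <= 1 by apply/andP; split; [exact: ler01|exact: lexx].
have c00 : c 0 = 0.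
  apply/eqP; rewrite -normr_le0 -[c 0]subr0.
  have vd' : `|b 0 + 0 *m e - w0| < d.
    by rewrite mul0mx addr0; exact: lt_trans (bd _ i0) d4.
  apply: le_trans (slice_injective (sd _ _ i0 i0) vd') _.
  rewrite mul0mx addr0 b0 linearB/=; have [_] := cP 0 i0; rewrite b0 => ->.
  by rewrite subrr normr0 mulr0.
have b1 : b 1 = w by rewrite /b scale1r addrC subrK.
have hw : h (w + c 1 *m e) = h v.
  by move: ha01; rewrite /a c00 mul0mx addr0 b0 b1.
exists (c 1 *m e); split => //; last by rewrite -{1}b1; exact: sd.
apply: le_trans (e_le _) _; rewrite -mulrA ler_wpM2l ?(ltW l0)//.
have wd' : `|w + 0 *m e - w0| < d.
  by rewrite mul0mx addr0; exact: lt_trans wd d4.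
have wd1 : `|w + c 1 *m e - w0| < d by rewrite -b1; exact: sd.
rewrite -[c 1]subr0; apply: le_trans (slice_injective wd1 wd') _.
by rewrite mul0mx addr0 hw -mulrA ler_wpM2l.
Qed.

End Fibres.

(** * The gradient inequality *)

Section GradientInequality.
Variables (R : realType) (F : completeNormedModType R) (dotF : {dot F for idfun}).
Hypothesis dotF_norm : forall v : F, `|v| ^+ 2 = dotF v v.
Variables (p : nat) (h : 'rV[R]_p -> F).
Hypothesis h_diff : forall w : 'rV[R]_p, differentiable h w.

(** Near [w0] the image of [h] is a manifold with tangent space the range of
    ['d h w] at [h w]: its chords are tangent up to second order in their own
    length. The tangent vector comes with a preimage [xi] of comparable size,
    which spares the adjoint of ['d h w] and its smallest singular value. *)
Lemma constant_rank_increments (w0 : 'rV[R]_p) :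
  locally_lipschitz_diff h ->
  (exists r : nat, \forall w \near w0, has_rank ('d h w) r) ->
  exists d C K M : R, [/\ 0 < d, 0 < C, 0 < K, 0 < M & forall v w,
    `|v - w0| < d -> `|w - w0| < d ->
    `|h v - h w| <= M * `|v - w| /\
    exists2 xi, `|xi| <= C * `|h v - h w| &
      `|h v - h w - 'd h w xi| <= K * `|h v - h w| ^+ 2].
Proof.
move=> h_lip [r /nbhs_normP [rho2 /= rho20 Drank]].
have [k [rho [k0 rho0 Dlip]]] := locally_lipschitz_ball w0 h_lip.
have rank0 : has_rank ('d h w0) r by apply: Drank; rewrite /= subrr normr0.
have [e [Q [q [q0 Q_le QA]]]] := has_rank_left_inverse dotF_norm rank0.
have [M0 M00 M0P] := linear_rV_bounded ('d h w0).
have [l l0 lP] := linear_rV_bounded (mulmxr e : {linear 'rV[R]_r -> 'rV[R]_p}).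
pose d := Num.min (Num.min rho rho2) (2 * q * k * l)^-1.
have d0 : 0 < d by rewrite !lt_min rho0 rho20 invr_gt0 !mulr_gt0.
have d_rho : d <= rho by rewrite /d !ge_min lexx.
have d_rho2 : d <= rho2 by rewrite /d !ge_min lexx orbT.
have d_small : q * k * d * l <= 2^-1.
  have : d <= (2 * q * k * l)^-1 by rewrite /d ge_min lexx orbT.
  rewrite -(@ler_pM2l _ (q * k * l)) ?mulr_gt0// => H.
  rewrite (_ : q * k * d * l = q * k * l * d); last by ring.
  apply: le_trans H _; rewrite le_eqVlt; apply/orP; left; apply/eqP.
  by field; rewrite !gt_eqF.
pose M := M0 + k * d.
have M_gt0 : 0 < M by rewrite addr_gt0// mulr_gt0.
have Dh_le w x : `|w - w0| < d -> `|'d h w x| <= M * `|x|.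
  move=> wd; rewrite -[X in `|X|](subrK ('d h w0 x)).
  apply: le_trans (ler_normD _ _) _; rewrite /M mulrDl addrC lerD//.
  apply: le_trans (Dlip _ _ _ _ _) _ => //; first exact: lt_le_trans d_rho.
    by rewrite subrr normr0.
  by rewrite ler_wpM2r// ler_wpM2l ?(ltW k0)// ltW.
have Dh_rank w : `|w - w0| < d -> has_rank ('d h w) r.
  by move=> wd; apply: Drank; rewrite /= distrC (lt_le_trans wd).
pose d1 := Num.min (d / 4) (d / (2 * l) / 2 / (q * M) / 2).
have d1_d4 : d1 <= d / 4 by rewrite /d1 ge_min lexx.
have d4 : d / 4 <= d by move: d0; lra.
exists d1, (l * (2 * q)), (k * (l * (2 * q)) ^+ 2), M; split=> //.
- by rewrite lt_min !divr_gt0// !mulr_gt0.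
- by rewrite !mulr_gt0.
- by rewrite mulr_gt0// exprn_gt0// !mulr_gt0.
move=> v w vd1 wd1.
have vd4 : `|v - w0| < d / 4 by exact: lt_le_trans d1_d4.
have wd4 : `|w - w0| < d / 4 by exact: lt_le_trans d1_d4.
have vd : `|v - w0| < d by exact: lt_le_trans d4.
have wd : `|w - w0| < d by exact: lt_le_trans d4.
split; first exact: (h_lipschitz dotF_norm h_diff Dh_le).
have small : q * M * `|w - v| <= d / (2 * l) / 2.
  have : `|w - v| <= d1 + d1.
    have -> : w - v = (w - w0) - (v - w0) by rewrite opprB addrA subrK.
    by apply: le_trans (ler_normB _ _) _; rewrite lerD// ltW.
  have : d1 <= d / (2 * l) / 2 / (q * M) / 2 by rewrite /d1 ge_min lexx orbT.
  set X := d / (2 * l) / 2 => H1 H2.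
  have : `|w - v| <= X / (q * M) by move: H1 H2; lra.
  by rewrite ler_pdivlMr ?mulr_gt0// mulrC.
have [xi [hxi xiC xid]] := fibre_correction dotF_norm h_diff k0 rho0 Dlip q0 l0
  M_gt0 d0 Q_le QA lP d_rho d_small Dh_le Dh_rank vd4 wd4 small.
exists xi => //.
have := taylor_quadratic dotF_norm h_diff k0 Dlip (lt_le_trans xid d_rho)
  (lt_le_trans wd d_rho).
rewrite hxi (_ : w + xi - w = xi); last by rewrite addrAC subrr add0r.
move=> /le_trans; apply.
rewrite -mulrA -exprMn ler_wpM2l ?(ltW k0)//.
by rewrite ler_sqr ?nnegrE// !mulr_ge0// ltW.
Qed.

Lemma gradient_objective (L : F -> R^o) (G : F -> F) (alpha : R) (w : 'rV[R]_p)
    (g : 'rV[R]_p) :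
  0 < alpha -> (forall x, is_gradient dotF L x (G x)) ->
  is_gradient (@edot R p) (objective h L alpha) w g ->
  forall x, edot g x = alpha^-1 * dotF (G (alpha *: h w)) ('d h w x).
Proof.
move=> a0 LG [_ dg] x; rewrite -dg.
have [Ld dL] := LG (alpha *: h w).
pose Dh : 'rV[R]_p -> F := 'd h w; pose ah : 'rV[R]_p -> F := alpha *: h.
have H1 : is_diff w ah (alpha *: Dh).
  by apply: is_diffZ; exact: differentiableP.
pose DL : F -> R^o := 'd L (ah w).
have H2 : is_diff w (L \o ah) (DL \o (alpha *: Dh)).
  by apply: is_diff_comp; exact: differentiableP.
have H3 : is_diff w (objective h L alpha)
    (alpha ^- 2 *: (DL \o (alpha *: Dh) : 'rV[R]_p -> R^o)).
  exact: (@is_diffZ _ _ _ _ _ (alpha ^- 2) _ H2).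
have [_ ->] := H3.
transitivity (alpha ^- 2 * DL (alpha *: Dh x)); first by [].
rewrite /DL [ah w]/(alpha *: h w) dL linearZ/= mulrA; congr (_ * _).
by field; rewrite gt_eqF.
Qed.

(** A Polyak-Lojasiewicz inequality with the gap measured to an arbitrary point
    [v] of the ball. Strong convexity of [L] bounds [f w - f v] by
    [- <G, u> / alpha - mu / 2 * |u| ^+ 2], where [u := h v - h w] and [G] is the
    gradient of [L] at [alpha *: h w]. Up to second order [u] is ['d h w xi],
    whose pairing with [G / alpha] is that of [xi] with the gradient of [f]; the
    second-order remainder costs half of the quadratic term because [G / alpha]
    is small for [w] near [w0] and [alpha] large. Maximizing the resulting
    quadratic polynomial in [|u|] gives the square of the gradient. *)
Lemma objective_gradient_inequality (L : F -> R^o) (w0 : 'rV[R]_p) :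
  locally_lipschitz_diff h ->
  lipschitz_gradient dotF L -> strongly_convex L -> h w0 = 0 ->
  (exists r : nat, \forall w \near w0, has_rank ('d h w) r) ->
  exists d alpha0 c : R, [/\ 0 < d, 0 < alpha0, 0 < c &
    forall alpha v w g, alpha0 <= alpha ->
    `|v - w0| < d -> `|w - w0| < d ->
    is_gradient (@edot R p) (objective h L alpha) w g ->
    2 * c * (objective h L alpha w - objective h L alpha v) <= edot g g].
Proof.
move=> h_lip [G LG /pinfty_ex_gt0 [Lam Lam0 GLam]] [mu mu0 Lmu] hw0 h_rank.
have [d [C [K [M [d0 C0 K0 M0 incr]]]]] := constant_rank_increments h_lip h_rank.
pose d' := Num.min d (mu / (8 * K * Lam * M)).
have d'0 : 0 < d' by rewrite lt_min d0 divr_gt0// !mulr_gt0.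
pose alpha0 := 8 * K * (`|G 0| + 1) / mu.
have alpha00 : 0 < alpha0 by rewrite divr_gt0// !mulr_gt0// ltr_wpDl.
pose C' := p.+1%:R * C.
have C'0 : 0 < C' by rewrite mulr_gt0.
exists d', alpha0, (mu / C' ^+ 2 / 2); split => //.
  by rewrite !divr_gt0// exprn_gt0.
move=> alpha v w g aalpha vd' wd' gradg.
have a0 : 0 < alpha by apply: lt_le_trans aalpha.
have vd : `|v - w0| < d by apply: lt_le_trans vd' _; rewrite /d' ge_min lexx.
have wd : `|w - w0| < d by apply: lt_le_trans wd' _; rewrite /d' ge_min lexx.
have [_ [xi xiC xiK]] := incr v w vd wd.
set u := h v - h w in xiC xiK.
have hw : `|h w| <= M * d'.
  have w0d : `|w0 - w0| < d by rewrite subrr normr0.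
  have [+ _] := incr w w0 wd w0d.
  rewrite hw0 subr0 => /le_trans; apply.
  by rewrite ler_wpM2l ?(ltW M0)// ltW.
(* |G (alpha h w)| / alpha is small: the first part by [alpha0 <= alpha],
   the second one because [h w] is close to [h w0 = 0]. *)
have Gsmall : alpha^-1 * `|G (alpha *: h w)| * K <= mu / 4.
  have GL : `|G (alpha *: h w)| <= `|G 0| + Lam * (alpha * (M * d')).
    rewrite -{1}(subrK (G 0) (G _)); apply: le_trans (ler_normD _ _) _.
    rewrite addrC lerD2l; have := GLam (alpha *: h w, 0) (conj I I).
    rewrite /= subr0 normrZ (gtr0_norm a0) => /le_trans; apply.
    by rewrite ler_wpM2l ?(ltW Lam0)// ler_wpM2l ?(ltW a0).
  have t1 : alpha^-1 * `|G 0| * K <= mu / 8.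
    rewrite -mulrA mulrC ler_pdivrMr//.
    have : mu / 8 * alpha0 <= mu / 8 * alpha by rewrite ler_wpM2l// divr_ge0// ltW.
    apply: le_trans.
    have -> : mu / 8 * alpha0 = K * (`|G 0| + 1) by rewrite /alpha0; field; rewrite gt_eqF.
    by rewrite mulrC ler_wpM2l ?(ltW K0)// lerDl.
  have t2 : Lam * (M * d') * K <= mu / 8.
    have : d' <= mu / (8 * K * Lam * M) by rewrite /d' ge_min lexx orbT.
    rewrite ler_pdivlMr ?mulr_gt0//; lra.
  apply: (@le_trans _ _ (alpha^-1 * (`|G 0| + Lam * (alpha * (M * d'))) * K)).
    by rewrite ler_wpM2r ?(ltW K0)// ler_wpM2l// invr_ge0 ltW.
  have -> : alpha^-1 * (`|G 0| + Lam * (alpha * (M * d'))) * K =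
    alpha^-1 * `|G 0| * K + Lam * (M * d') * K by field; rewrite gt_eqF.
  by move: t1 t2; lra.
have gE := gradient_objective a0 LG gradg.
have tangent := strongly_convex_above_tangent LG Lmu (alpha *: h w) (alpha *: h v).
have lower : objective h L alpha w - objective h L alpha v <=
    - (alpha^-1 * dotF (G (alpha *: h w)) u) - mu / 2 * `|u| ^+ 2.
  rewrite /objective -mulrBr.
  have -> : - (alpha^-1 * dotF (G (alpha *: h w)) u) - mu / 2 * `|u| ^+ 2 =
      alpha ^- 2 * (- (alpha * dotF (G (alpha *: h w)) u
        + mu / 2 * (alpha ^+ 2 * `|u| ^+ 2))) by field; rewrite gt_eqF.
  rewrite ler_wpM2l ?invr_ge0 ?sqr_ge0//.
  move: tangent; rewrite -scalerBr -/u linearZ/= normrZ exprMn.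
  rewrite real_normK ?num_real//; lra.
have split_u : - (alpha^-1 * dotF (G (alpha *: h w)) u) <=
    C' * enorm g * `|u| + mu / 4 * `|u| ^+ 2.
  have -> : alpha^-1 * dotF (G (alpha *: h w)) u =
      edot g xi + alpha^-1 * dotF (G (alpha *: h w)) (u - 'd h w xi).
    rewrite gE -mulrDr -linearDr; congr (_ * dotF _ _).
    by rewrite addrC subrK.
  rewrite opprD lerD//.
    have -> : - edot g xi = edot g (- xi).
      by rewrite !edotE -sumrN; apply: eq_bigr => i _; rewrite !mxE mulrN.
    apply: le_trans (edot_le _ _) _.
    have : enorm (- xi) <= C' * `|u|.
      apply: le_trans (enorm_le_norm _) _.
      by rewrite normrN /C' -mulrA ler_wpM2l.
    by move=> H; rewrite (mulrC C') -mulrA ler_wpM2l ?enorm_ge0.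
  rewrite -mulrN; apply: le_trans (ler_norm _) _.
  rewrite normrM normrN (gtr0_norm (_ : 0 < alpha^-1)) ?invr_gt0//.
  apply: (@le_trans _ _ (alpha^-1 * (`|G (alpha *: h w)| * (K * `|u| ^+ 2)))).
    rewrite ler_wpM2l ?invr_ge0 ?(ltW a0)//.
    apply: le_trans (dotF_CS dotF_norm _ _) _.
    by rewrite ler_wpM2l.
  have := sqr_ge0 `|u|; move: (`|u| ^+ 2) => U U0.
  by rewrite !mulrA ler_wpM2r.
have quadratic_bound : objective h L alpha w - objective h L alpha v <=
    C' * enorm g * `|u| - mu / 4 * `|u| ^+ 2 by move: lower split_u; lra.
rewrite -enorm_sqr.
have -> : 2 * (mu / C' ^+ 2 / 2) = mu / C' ^+ 2 by field; rewrite gt_eqF.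
rewrite mulrAC ler_pdivrMr ?exprn_gt0//.
apply: le_trans (ler_wpM2l (ltW mu0) quadratic_bound) _.
have := sqr_ge0 (C' * enorm g - mu / 2 * `|u|).
have -> : (C' * enorm g - mu / 2 * `|u|) ^+ 2 = enorm g ^+ 2 * C' ^+ 2 -
    mu * (C' * enorm g * `|u| - mu / 4 * `|u| ^+ 2) by field.
by rewrite subr_ge0.
Qed.

End GradientInequality.

(** * Gradient flows under the gradient inequality *)

Section Calculus.
Variable R : realType.

Lemma linear_rV_continuous (p : nat) (V : normedModType R)
  (l : {linear 'rV[R]_p -> V}) : continuous l.
Proof.
have [M M0 lM] := linear_rV_bounded l.
apply: bounded_linear_continuous; apply/bounded_funP => r.
exists (M * r) => x xr; apply: le_trans (lM x) _.
by rewrite ler_wpM2l ?(ltW M0).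
Qed.

Lemma is_derive_edot (p : nat) (u : 'rV[R]_p) (w : R -> 'rV[R]_p) (t : R) dw :
  is_derive t (1 : R) w dw ->
  is_derive t (1 : R) (fun t => edot u (w t)) (edot u dw).
Proof.
have ul : linear (edot u : 'rV[R]_p -> R^o) by move=> a x y; exact: edot_linearr.
pose l : {linear 'rV[R]_p -> R^o} :=
  HB.pack (edot u : 'rV[R]_p -> R^o) (GRing.isLinear.Build _ _ _ _ _ ul).
by move=> ?; apply: (@is_derive_linear _ _ _ l) => //; exact: linear_rV_continuous.
Qed.

Lemma edot_continuous (p : nat) (u : 'rV[R]_p) : continuous (edot u).
Proof.
have ul : linear (edot u : 'rV[R]_p -> R^o) by move=> a x y; exact: edot_linearr.
pose l : {linear 'rV[R]_p -> R^o} :=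
  HB.pack (edot u : 'rV[R]_p -> R^o) (GRing.isLinear.Build _ _ _ _ _ ul).
exact: (@linear_rV_continuous _ _ l).
Qed.

Lemma is_derive_path (V W : normedModType R) (f : V -> W) (w : R -> V) (t : R) dw :
  differentiable f (w t) -> is_derive t (1 : R) w dw ->
  is_derive t (1 : R) (fun t => f (w t)) ('d f (w t) dw).
Proof.
move=> df [wd wE].
have dw' : differentiable w t by apply/derivable1_diffP.
have dfw : differentiable (f \o w) t by exact: differentiable_comp.
split; first exact: diff_derivable.
have := @deriveE _ _ _ (f \o w) t (1 : R) dfw; rewrite /comp => ->.
by rewrite -/(f \o w) diff_comp//= -(@deriveE _ _ _ w)// wE.
Qed.

Lemma is_derive_expRM (k t : R) :
  is_derive t (1 : R) (fun t => expR (k * t)) (expR (k * t) * k).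
Proof.
have H : is_derive t (1 : R) (k *: @id R) k.
  by apply: is_derive_eq; rewrite /GRing.scale/= mulr1.
exact: (@is_derive1_comp R expR (k *: @id R) t (expR (k * t)) k).
Qed.

Lemma expR_tail (A k e : R) : 0 <= A -> 0 < k -> 0 < e ->
  \forall t \near +oo, A * expR (- k * t) < e.
Proof.
move=> A0 k0 e0; near=> t.
have t0 : 0 < t by near: t; apply: nbhs_pinfty_gt; exact: num_real.
have tA : A / (k * e) < t by near: t; apply: nbhs_pinfty_gt; exact: num_real.
rewrite mulNr expRN ltr_pdivrMr ?expR_gt0//.
apply: (@lt_le_trans _ _ (e * (k * t))).
  by move: tA; rewrite ltr_pdivrMr ?mulr_gt0//; congr (_ < _); ring.
rewrite ler_wpM2l ?(ltW e0)//.
by have := expR_ge1Dx (k * t); lra.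
Unshelve. all: by end_near. Qed.

(** A positive time is interior to the half-line of nonnegative times, so the
    restriction to that half-line does not affect the limit. *)
Lemma one_sided_derive (V : normedModType R) (w : R -> V) (t : R) (l : V) :
  0 < t ->
  (s - t)^-1 *: (w s - w t) @[s --> within [set s : R | 0 <= s] t^'] --> l ->
  is_derive t (1 : R) w l.
Proof.
move=> t0 wl.
have C : (fun k : R => k^-1 *: ((w \o shift t) (k *: (1 : R)) - w t)) @ 0^' --> l.
  apply/cvgrPdist_lt => e e0.
  move/cvgrPdist_lt : wl => /(_ e e0).
  rewrite !near_withinE => /nbhs_normP [d /= d0 dP].
  apply/nbhs_normP; exists (Num.min d t) => /=; first by rewrite lt_min d0.
  move=> k /=; rewrite sub0r normrN lt_min => /andP[kd kt] k0.
  have kk : k%:A = k by rewrite [k%:A]mulr1.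
  have := dP (k + t); rewrite /= (_ : t - (k + t) = - k); last by ring.
  rewrite normrN addrK kk => /(_ kd); apply.
    by rewrite -subr_eq0 addrK.
  by move: kt; rewrite ltr_norml => /andP[+ _]; lra.
split; first by apply/cvg_ex; exists l.
exact: cvg_lim.
Qed.

Lemma one_sided_lipschitz (V : normedModType R) (w : R -> V) (t : R) (l : V) :
  (s - t)^-1 *: (w s - w t) @[s --> within [set s : R | 0 <= s] t^'] --> l ->
  exists2 d : R, 0 < d & forall s, 0 <= s -> `|s - t| < d ->
    `|w s - w t| <= (`|l| + 1) * `|s - t|.
Proof.
move/cvgrPdist_lt => /(_ 1 ltr01).
rewrite !near_withinE => /nbhs_normP [d /= d0 dP].
exists d => // s s0 sd.
have [->|st] := eqVneq s t; first by rewrite !subrr !normr0 mulr0.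
have := dP s; rewrite /= distrC => /(_ sd st s0).
have st0 : 0 < `|s - t| by rewrite normr_gt0 subr_eq0.
set q := _ *: _ => H.
have -> : w s - w t = (s - t) *: q.
  by rewrite /q scalerA mulfV ?subr_eq0// scale1r.
rewrite normrZ mulrC ler_wpM2r//.
rewrite -{1}(subrK l q); apply: le_trans (ler_normD _ _) _.
by rewrite addrC lerD2l distrC ltW.
Qed.

End Calculus.

Section Flow.
Variables (R : realType) (p : nat) (f : 'rV[R]_p -> R^o).
Hypothesis f_ge0 : forall x : 'rV[R]_p, 0 <= f x.
Variables (w0 : 'rV[R]_p) (delta c : R).
Hypotheses (delta0 : 0 < delta) (c0 : 0 < c).
Hypothesis f_PL : forall v x g : 'rV[R]_p, `|v - w0| <= delta -> `|x - w0| <= delta ->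
  is_gradient (@edot R p) f x g -> 2 * c * (f x - f v) <= edot g g.
Variables (w g : R -> 'rV[R]_p).
Hypothesis w_0 : w 0 = w0.
Hypothesis g_grad : forall t : R, 0 <= t -> is_gradient (@edot R p) f (w t) (g t).
Hypothesis w_flow : forall t : R, 0 <= t ->
  (s - t)^-1 *: (w s - w t) @[s --> within [set s : R | 0 <= s] t^'] --> - g t.

(* The infimum over the ball stands for the value of a local minimum whose
   existence is not known yet. *)
Let m := inf [set f v | v in [set v | `|v - w0| <= delta]].

Lemma lbound_values : lbound [set f v | v in [set v | `|v - w0| <= delta]] 0.
Proof. by move=> _ [v _ <-]. Qed.

Lemma inf_le (v : 'rV[R]_p) : `|v - w0| <= delta -> m <= f v.
Proof.
move=> vd; apply: ge_inf; first by exists 0; exact: lbound_values.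
by exists v.
Qed.

Lemma inf_ge0 : 0 <= m.
Proof.
apply: lb_le_inf lbound_values; exists (f w0), w0 => //=.
by rewrite subrr normr0 ltW.
Qed.

Lemma gap_le_gradient (t : R) : 0 <= t -> `|w t - w0| <= delta ->
  2 * c * (f (w t) - m) <= edot (g t) (g t).
Proof.
move=> t0 td; rewrite mulrC -ler_pdivlMr ?mulr_gt0// lerBlDr -lerBlDl.
apply: lb_le_inf.
  by exists (f w0), w0 => //=; rewrite subrr normr0 ltW.
move=> _ [v /= vd <-]; rewrite lerBlDl -lerBlDr ler_pdivlMr ?mulr_gt0// mulrC.
exact: f_PL (g_grad t0).
Qed.

Lemma flow_is_derive (t : R) : 0 < t -> is_derive t (1 : R) w (- g t).
Proof. by move=> t0; apply: one_sided_derive => //; exact/w_flow/ltW. Qed.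

Lemma flow_value_is_derive (t : R) : 0 < t ->
  is_derive t (1 : R) (fun t : R => f (w t)) (- edot (g t) (g t)).
Proof.
move=> t0; have [fd fE] := g_grad (ltW t0).
have -> : - edot (g t) (g t) = 'd f (w t) (- g t).
  by rewrite fE !edotE -sumrN; apply: eq_bigr => i _; rewrite !mxE mulrN.
exact/is_derive_path/flow_is_derive.
Qed.

Lemma flow_continuous (T t : R) : 0 <= t ->
  w s @[s --> within `[0, T] (nbhs t)] --> w t.
Proof.
move=> t0; have [d d0 dP] := one_sided_lipschitz (w_flow t0).
apply/cvgrPdist_lt => e e0; rewrite near_withinE; apply/nbhs_normP.
set l := `|- g t| + 1 in dP.
have l0 : 0 < l by rewrite ltr_wpDl.
exists (Num.min d (e / l)) => /=; first by rewrite lt_min d0 divr_gt0.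
move=> s /=; rewrite distrC lt_min => /andP[sd sl].
rewrite in_itv/= => /andP[s0 _]; rewrite distrC.
apply: le_lt_trans (dP s s0 sd) _.
by rewrite mulrC -ltr_pdivlMr.
Qed.

Lemma flow_value_continuous (T t : R) : 0 <= t ->
  f (w s) @[s --> within `[0, T] (nbhs t)] --> f (w t).
Proof.
move=> t0; have [fd _] := g_grad t0.
apply: (@continuous_cvg _ _ _ _ _ w f (w t)); last exact: flow_continuous.
exact: differentiable_continuous.
Qed.

Lemma expRM_within (T k t : R) :
  expR (k * s) @[s --> within `[0, T] (nbhs t)] --> expR (k * t).
Proof.
apply: cvg_trans; first by apply: cvg_app; exact: cvg_within.
apply: (@differentiable_continuous _ _ _ t (fun s : R => expR (k * s))).
by apply/derivable1_diffP; have [] := is_derive_expRM k t.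
Qed.

Variable T : R.
Hypothesis w_near : forall t : R, 0 <= t <= T -> `|w t - w0| <= delta.

(** By the gradient inequality the derivative of the gap is at most
    [- 2 * c] times the gap, so the gap times [expR (2 * c * t)] decreases. *)
Lemma gap_decay (s : R) : 0 <= s <= T ->
  f (w s) - m <= f w0 * expR (- (2 * c) * s).
Proof.
move=> /andP[s0 sT].
pose Z (t : R) : R := (f (w t) - m) * expR (2 * c * t).
have dZ (t : R) : 0 < t -> is_derive t (1 : R) Z
    ((f (w t) - m) * (expR (2 * c * t) * (2 * c)) -
     edot (g t) (g t) * expR (2 * c * t)).
  move=> t0.
  have H1 : is_derive t (1 : R) ((fun t : R => f (w t)) - cst m)
      (- edot (g t) (g t) - 0).
    by apply: is_deriveB; exact: flow_value_is_derive.
  have H2 := is_derive_expRM (2 * c) t.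
  apply: is_derive_eq (is_deriveM H1 H2) _.
  rewrite subr0 /GRing.scale/= (_ : (_ - cst m) t = f (w t) - m)//.
  by rewrite mulrN mulrC [X in _ - X]mulrC mulrC.
have ZZ : Z s <= Z 0.
  apply: (@ler0_derive1_nincr _ Z 0 T) => //.
  - by move=> x; rewrite in_itv/= => /andP[x0 _]; have [] := dZ x x0.
  - move=> x; rewrite in_itv/= => /andP[x0 xT].
    rewrite derive1E; have [_ ->] := dZ x x0.
    have := gap_le_gradient (ltW x0) (w_near _).
    rewrite (ltW x0) (ltW xT) => /(_ isT) H.
    rewrite [X in X - _](_ : _ = (2 * c * (f (w x) - m)) * expR (2 * c * x)); last by ring.
    by rewrite -mulrBl mulr_le0_ge0 ?expR_ge0// subr_le0.
  - apply/subspace_continuousP => x; rewrite /= in_itv/= => /andP[x0 _].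
    apply: cvgM; last exact: expRM_within.
    by apply: cvgB; [exact: flow_value_continuous|exact: cvg_cst].
rewrite mulNr expRN ler_pdivlMr ?expR_gt0//.
apply: le_trans ZZ _; rewrite /Z w_0 mulr0 expR0 mulr1.
by rewrite lerBlDr lerDl inf_ge0.
Qed.

Variable eta : R.
Hypothesis eta0 : 0 < eta.

Let B : R := f w0 / eta + eta / (2 * c).

(** The path has finite length: with [a := expR (c * t)], the speed [|g|] is at
    most [a * |g| ^+ 2 / (2 * eta) + eta / (2 * a)]. The first term is bounded by
    the decrease of [a / eta] times the gap, because half of [|g| ^+ 2] already
    compensates the growth of [a], and the second one is integrable. The usual
    argument differentiates the square root of the gap, which is singular where
    the gap vanishes. The function [Z] adds the two compensating terms to the
    coordinate along [u], which makes it nonincreasing. *)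
Lemma flow_displacement_dir (u : 'rV[R]_p) (s t : R) : enorm u <= 1 ->
  0 <= s -> s <= t -> t <= T ->
  edot u (w t) - edot u (w s) <= B * expR (- c * s).
Proof.
move=> u1 s0 st tT.
pose Z (t : R) : R := edot u (w t) + (f (w t) - m) * (expR (c * t) / eta) +
  expR (- c * t) * (eta / (2 * c)).
have dZ (x : R) : 0 < x -> is_derive x (1 : R) Z
    (edot u (- g x) + ((f (w x) - m) * ((expR (c * x) * c) / eta) -
     edot (g x) (g x) * (expR (c * x) / eta)) +
     (expR (- c * x) * - c) * (eta / (2 * c))).
  move=> x0.
  have H1 : is_derive x (1 : R) ((fun t : R => f (w t)) - cst m)
      (- edot (g x) (g x) - 0).
    by apply: is_deriveB; exact: flow_value_is_derive.
  have H2 : is_derive x (1 : R) ((fun t : R => expR (c * t)) * cst eta^-1)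
      (expR (c * x) *: 0 + eta^-1 *: (expR (c * x) * c)).
    by apply: is_deriveM; exact: is_derive_expRM.
  have H3 : is_derive x (1 : R)
      ((fun t : R => expR (- c * t)) * cst (eta / (2 * c)))
      (expR (- c * x) *: 0 + (eta / (2 * c)) *: (expR (- c * x) * - c)).
    by apply: is_deriveM; exact: is_derive_expRM.
  have H4 := is_derive_edot u (flow_is_derive x0).
  have := is_deriveD (is_deriveD H4 (is_deriveM H1 H2)) H3.
  move=> H; apply: is_derive_eq H _.
  rewrite !scaler0 !add0r subr0 /GRing.scale/= (_ : (_ - cst m) x = f (w x) - m)//.
  rewrite (_ : (_ * cst eta^-1) x = expR (c * x) / eta)//.
  by rewrite mulrN [eta^-1 * _]mulrC [_ * edot _ _]mulrC [X in _ + X = _]mulrC.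
have ZZ : Z t <= Z s.
  apply: (@ler0_derive1_nincr _ Z 0 T) => //.
  - by move=> x; rewrite in_itv/= => /andP[x0 _]; have [] := dZ x x0.
  - move=> x; rewrite in_itv/= => /andP[x0 xT].
    rewrite derive1E; have [_ ->] := dZ x x0.
    have := gap_le_gradient (ltW x0) (w_near _).
    rewrite (ltW x0) (ltW xT) => /(_ isT).
    have : edot u (- g x) <= enorm (g x).
      apply: le_trans (edot_le _ _) _.
      rewrite -[- g x]sub0r enormB subr0 -[leRHS]mul1r.
      by rewrite ler_wpM2r ?enorm_ge0.
    rewrite -enorm_sqr mulNr expRN.
    have := expR_gt0 (c * x); move: (expR (c * x)) => a a0.
    move: (edot u _) (enorm (g x)) (f (w x) - m) => U N G UN GN.
    have : G * (a * c / eta) <= N ^+ 2 / 2 * (a / eta).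
      have -> : G * (a * c / eta) = (c * G) * (a / eta) by ring.
      rewrite ler_wpM2r//; first by rewrite divr_ge0// ltW.
      by move: GN; lra.
    have : 0 <= (a * N - eta) ^+ 2 / (2 * a * eta).
      by rewrite divr_ge0 ?sqr_ge0// !mulr_ge0 ?ltW.
    have -> : (a * N - eta) ^+ 2 / (2 * a * eta) =
        N ^+ 2 / 2 * (a / eta) - N + eta / (2 * a).
      by field; rewrite !gt_eqF.
    have -> : a^-1 * - c * (eta / (2 * c)) = - (eta / (2 * a)).
      by field; rewrite !gt_eqF.
    rewrite (_ : N ^+ 2 * (a / eta) = 2 * (N ^+ 2 / 2 * (a / eta))); last first.
      by field; rewrite gt_eqF.
    by move: UN; lra.
  - apply/subspace_continuousP => x; rewrite /= in_itv/= => /andP[x0 _].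
    apply: cvgD; last first.
      by apply: cvgM; [exact: expRM_within|exact: cvg_cst].
    apply: cvgD.
      apply: (@continuous_cvg _ _ _ _ _ w (edot u) (w x)).
        exact: edot_continuous.
      exact: flow_continuous.
    apply: cvgM.
      by apply: cvgB; [exact: flow_value_continuous|exact: cvg_cst].
    by apply: cvgM; [exact: expRM_within|exact: cvg_cst].
have t0 : 0 <= t by exact: le_trans st.
have Gt : 0 <= f (w t) - m.
  by rewrite subr_ge0; apply: inf_le; apply: w_near; rewrite t0.
have Gs := gap_decay (s := s); rewrite s0 (le_trans st tT) in Gs.
have {}Gs := Gs isT.
have : edot u (w t) <= Z t.
  rewrite /Z -addrA lerDl addr_ge0// mulr_ge0 ?expR_ge0//.
    by rewrite divr_ge0 ?expR_ge0// ltW.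
  by rewrite divr_ge0 ?mulr_ge0// ltW.
move=> /le_trans /(_ ZZ); rewrite /Z -addrA -lerBlDl => /le_trans; apply.
rewrite /B [leRHS]mulrDl lerD//; last by rewrite mulrC.
rewrite mulrA [leRHS]mulrAC ler_wpM2r ?invr_ge0 ?(ltW eta0)//.
apply: le_trans (ler_wpM2r (expR_ge0 (c * s)) Gs) _.
by rewrite -mulrA -expRD (_ : - (2 * c) * s + c * s = - c * s)//; ring.
Qed.

Lemma flow_displacement (s t : R) : 0 <= s -> s <= t -> t <= T ->
  enorm (w t - w s) <= B * expR (- c * s).
Proof.
move=> s0 st tT; set v := w t - w s.
have B0 : 0 <= B.
  apply: addr_ge0; apply: divr_ge0 => //; try exact: ltW.
  by apply: mulr_ge0 => //; exact: ltW.
have [vn0|vn0] := eqVneq (enorm v) 0.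
  by rewrite vn0; apply: mulr_ge0 => //; exact: expR_ge0.
have v0 : 0 < enorm v by rewrite lt_neqAle eq_sym vn0 enorm_ge0.
have u1 : enorm ((enorm v)^-1 *: v) <= 1.
  by rewrite enormZ normfV (gtr0_norm v0) mulVf.
have := flow_displacement_dir u1 s0 st tT.
by rewrite -edotBr -/v edotZl -enorm_sqr expr2 mulrA mulVf// mul1r.
Qed.

End Flow.

Section Convergence.
Variables (R : realType) (p : nat) (f : 'rV[R]_p -> R^o).
Hypothesis f_ge0 : forall x : 'rV[R]_p, 0 <= f x.
Hypothesis f_continuous : continuous f.
Variables (w0 : 'rV[R]_p) (delta c eta : R).
Hypotheses (delta0 : 0 < delta) (c0 : 0 < c) (eta0 : 0 < eta).
Hypothesis f_PL : forall v x g : 'rV[R]_p, `|v - w0| <= delta -> `|x - w0| <= delta ->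
  is_gradient (@edot R p) f x g -> 2 * c * (f x - f v) <= edot g g.

Let B : R := f w0 / eta + eta / (2 * c).
Hypothesis B_delta : B < delta.

Variables (w g : R -> 'rV[R]_p).
Hypothesis w_0 : w 0 = w0.
Hypothesis g_grad : forall t : R, 0 <= t -> is_gradient (@edot R p) f (w t) (g t).
Hypothesis w_flow : forall t : R, 0 <= t ->
  (s - t)^-1 *: (w s - w t) @[s --> within [set s : R | 0 <= s] t^'] --> - g t.

Lemma displacement_bound_ge0 : 0 <= B.
Proof.
apply: addr_ge0; apply: divr_ge0 => //; try exact: ltW.
by apply: mulr_ge0 => //; exact: ltW.
Qed.

(** As long as the flow has stayed in the ball of radius [delta], it is in fact
    within [B < delta] of its origin, so it cannot reach the boundary. *)
Lemma flow_stays (t : R) : 0 <= t -> `|w t - w0| <= delta.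
Proof.
move=> t0; apply/negP => /negP tout.
pose S := [set s : R | 0 <= s /\ forall r : R, 0 <= r <= s -> `|w r - w0| <= delta].
have S0 : S 0.
  split=> // r /andP[r0 r0']; have -> : r = 0 by apply/eqP; rewrite eq_le r0 r0'.
  by rewrite w_0 subrr normr0 ltW.
have St s : S s -> s <= t.
  move=> [_ sP]; rewrite leNgt; apply/negP => ts; move: tout.
  by rewrite sP// t0 ltW.
have hS : has_sup S by split; [exists 0|exists t].
pose tau := sup S.
have tau0 : 0 <= tau by apply: ub_le_sup => //; exists t.
have [e e0 eP] := one_sided_lipschitz (w_flow tau0).
set l := `|- g tau| + 1 in eP.
have l0 : 0 < l by rewrite ltr_wpDl.
pose e' := Num.min e ((delta - B) / 2 / l).
have e'0 : 0 < e' by rewrite lt_min e0 !divr_gt0// subr_gt0.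
have near_tau s : 0 <= s -> `|s - tau| < e' -> `|w s - w tau| <= (delta - B) / 2.
  move=> s0; rewrite lt_min => /andP[se sl].
  by apply: le_trans (eP s s0 se) _; rewrite mulrC -ler_pdivlMr// ltW.
have [s [s0 sS] stau] := sup_adherent e'0 hS.
have stau' : s <= tau by apply: ub_le_sup => //; exists t.
have sB : `|w s - w0| <= B.
  apply: le_trans (norm_le_enorm _) _; rewrite -w_0.
  have := flow_displacement f_ge0 delta0 c0 f_PL w_0 g_grad w_flow sS eta0
    (lexx 0) s0 (lexx s).
  by rewrite mulr0 expR0 mulr1.
(* The flow is strictly inside the ball just before tau, hence also just
   after it, which contradicts the choice of tau. *)
suff : S (tau + e' / 2).
  by move=> /(ub_le_sup _) H; have : tau + e' / 2 <= tau by [apply: H; exists t]; move: e'0; lra.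
split; first by move: tau0 e'0; lra.
move=> r /andP[r0 rtau].
have [rs|sr] := leP r s; first by apply: sS; rewrite r0.
have H1 : `|w r - w tau| <= (delta - B) / 2.
  by apply: near_tau => //; rewrite ltr_norml; move: e'0 stau sr rtau; rewrite -/tau; lra.
have H2 : `|w s - w tau| <= (delta - B) / 2.
  by apply: near_tau => //; rewrite ltr_norml; move: e'0 stau stau'; rewrite -/tau; lra.
have -> : w r - w0 = (w r - w tau) - (w s - w tau) + (w s - w0).
  by rewrite opprB !subrKA.
apply: le_trans (ler_normD _ _) _.
have := ler_normB (w r - w tau) (w s - w tau).
by move: H1 H2 sB; lra.
Qed.

Lemma flow_cauchy (s t : R) : 0 <= s -> s <= t ->
  enorm (w t - w s) <= B * expR (- c * s).
Proof.
move=> s0 st; apply: (flow_displacement f_ge0 delta0 c0 f_PL w_0 g_grad w_flow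
  (T := t)) => // r /andP[r0 _].
exact: flow_stays.
Qed.

Lemma flow_cvg : cvg (w t @[t --> +oo]).
Proof.
apply/cauchy_cvgP/cauchyP => e e0.
have e20 : 0 < e / 2 by rewrite divr_gt0.
near (+oo : set_system R) => s.
have s0 : 0 <= s by apply: ltW; near: s; apply: nbhs_pinfty_gt; exact: num_real.
have sB : B * expR (- c * s) < e / 2 by near: s; exact: expR_tail displacement_bound_ge0 c0 e20.
exists (w s); suff : \forall t \near +oo, ball (w s) e (w t) by [].
near=> t.
have st : s <= t by apply: ltW; near: t; apply: nbhs_pinfty_gt; exact: num_real.
rewrite -ball_normE /= distrC; apply: le_lt_trans (norm_le_enorm _) _.
apply: le_lt_trans (flow_cauchy s0 st) _.
by apply: lt_trans sB _; move: e0; lra.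
Unshelve. all: by end_near. Qed.

Let winf := lim (w t @[t --> +oo]).

Lemma flow_rate (s : R) : 0 <= s -> enorm (w s - winf) <= B * expR (- c * s).
Proof.
move=> s0; apply/ler_addgt0Pr => e e0.
have /cvgrPdist_lt /(_ (e / p.+1%:R)) := flow_cvg.
rewrite divr_gt0// => /(_ isT) H.
near (+oo : set_system R) => t.
have st : s <= t by apply: ltW; near: t; apply: nbhs_pinfty_gt; exact: num_real.
have tw : `|winf - w t| < e / p.+1%:R by near: t.
rewrite enormB -[winf - w s](subrKA (w t)).
apply: le_trans (enormD _ _) _; rewrite addrC lerD//; first exact: flow_cauchy.
apply: le_trans (enorm_le_norm _) _.
by rewrite mulrC -ler_pdivlMr// ltW.
Unshelve. all: by end_near. Qed.

(** At the limit the gap to the infimum over the ball is zero, and the limit is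
    an interior point of the ball. *)
Lemma flow_limit_local_minimum : local_minimum f winf.
Proof.
pose m := inf [set f v | v in [set v | `|v - w0| <= delta]].
have winfB : `|winf - w0| <= B.
  rewrite distrC -w_0; apply: le_trans (norm_le_enorm _) _.
  by have := flow_rate (lexx 0); rewrite mulr0 expR0 mulr1.
have fm : f winf <= m.
  apply/ler_addgt0Pr => e e0.
  have e20 : 0 < e / 2 by rewrite divr_gt0.
  have C : f (w t) @[t --> +oo] --> f winf.
    by apply: continuous_cvg; [exact: f_continuous|exact: flow_cvg].
  move/cvgrPdist_lt : C => /(_ _ e20) C.
  near (+oo : set_system R) => t.
  have t0 : 0 <= t by apply: ltW; near: t; apply: nbhs_pinfty_gt; exact: num_real.
  have H1 : `|f winf - f (w t)| < e / 2 by near: t.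
  have H2 : f w0 * expR (- (2 * c) * t) < e / 2.
    by near: t; apply: expR_tail => //; rewrite mulr_gt0.
  have H3 : f (w t) - m <= f w0 * expR (- (2 * c) * t).
    apply: (gap_decay f_ge0 delta0 c0 f_PL w_0 g_grad w_flow (T := t)).
      by move=> r /andP[r0 _]; exact: flow_stays.
    by rewrite t0 lexx.
  by move: H1 H2 H3; rewrite ltr_norml => /andP[_]; lra.
rewrite /local_minimum; near=> y.
apply: le_trans fm _; apply: (inf_le f_ge0).
have : `|winf - y| < delta - B.
  by near: y; apply: cvgr_dist_lt; [exact: cvg_id|rewrite subr_gt0].
have : `|y - w0| <= `|winf - y| + `|winf - w0|.
  by rewrite -[y - w0](subrKA winf) (distrC winf y) ler_normD.
by move: winfB; lra.
Unshelve. all: by end_near. Qed.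

End Convergence.

Theorem theorem2p5 (R : realType)
    (F : completeNormedModType R) (dotF : {dot F for idfun})
    (dotF_norm : forall v : F, `|v| ^+ 2 = dotF v v)
    (F_separable : separable_space F)
    (p : nat) (h : 'rV[R]_p -> F)
    (h_diff : forall w : 'rV[R]_p, differentiable h w)
    (Dh_lip : locally_lipschitz_diff h)
    (L : F -> R^o)
    (L_ge0 : forall y : F, 0 <= L y)
    (L_diff : forall y : F, differentiable L y)
    (gradL_lip : lipschitz_gradient dotF L)
    (L_convex : strongly_convex L)
    (w0 : 'rV[R]_p)
    (h_w0 : h w0 = 0)
    (Dh_rank : exists r : nat, \forall w \near w0, has_rank ('d h w) r) :
  exists2 alpha0 : R, 0 < alpha0 &
    exists c C : R, 0 < c /\
      forall (alpha : R) (w : R -> 'rV[R]_p), alpha0 <= alpha ->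
        gradient_flow (objective h L alpha) w0 w ->
        exists2 winf : 'rV[R]_p, local_minimum (objective h L alpha) winf &
          forall t : R, 0 <= t -> enorm (w t - winf) <= C * expR (- c * t).
Proof.
have [d [alpha1 [c [d0 alpha10 c0 PL]]]] := objective_gradient_inequality
  dotF_norm h_diff Dh_lip gradL_lip L_convex h_w0 Dh_rank.
pose delta := d / 2; have delta0 : 0 < delta by rewrite divr_gt0.
have delta_d : delta < d by rewrite /delta; move: d0; lra.
(* eta makes the second term of the displacement bound equal to delta / 4, and
   alpha ^+ 2 >= alpha >= A makes the first one at most delta / 4. *)
pose eta := c * delta / 2; have eta0 : 0 < eta by rewrite !(divr_gt0, mulr_gt0).
pose A := 4 * L 0 / (delta * eta).
have A0 : 0 <= A by rewrite divr_ge0// mulr_ge0// ltW.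
exists (alpha1 + A + 1); first by move: alpha10 A0; lra.
exists c, delta; split=> // alpha w alphaP [w_0 flow].
have alpha_alpha1 : alpha1 <= alpha by move: alphaP A0; lra.
have alpha_ge1 : 1 <= alpha by move: alphaP A0 alpha10; lra.
have alpha_A : A <= alpha by move: alphaP alpha10; lra.
have alpha0 : 0 < alpha by apply: lt_le_trans alpha_ge1.
set f := objective h L alpha.
have f_ge0 x : 0 <= f x.
  by apply: mulr_ge0 => //; rewrite invr_ge0 sqr_ge0.
have f_cont : continuous f.
  move=> x; apply: (@differentiable_continuous _ _ _ x f).
  have D1 : differentiable (alpha *: h) x by exact: differentiableZ.
  have D2 : differentiable (L \o (alpha *: h)) x by exact: differentiable_comp.
  exact: (@differentiableZ _ _ _ _ (alpha ^- 2) _ D2).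
have f_PL v x g : `|v - w0| <= delta -> `|x - w0| <= delta ->
    is_gradient (@edot R p) f x g -> 2 * c * (f x - f v) <= edot g g.
  by move=> vd xd; apply: PL => //; exact: le_lt_trans delta_d.
have B_small : f w0 / eta + eta / (2 * c) <= delta / 2.
  have -> : eta / (2 * c) = delta / 4 by rewrite /eta; field; rewrite gt_eqF.
  suff : f w0 / eta <= delta / 4 by lra.
  rewrite ler_pdivrMr// /f /objective h_w0 scaler0 mulrC ler_pdivrMr ?exprn_gt0//.
  have : L 0 = A * (delta * eta / 4).
    by rewrite /A; field; rewrite !gt_eqF.
  move=> ->; rewrite mulrC [leRHS](_ : _ = delta * eta / 4 * alpha ^+ 2); last by ring.
  rewrite ler_wpM2l//; first by apply/ltW; rewrite divr_gt0 ?mulr_gt0.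
  by apply: le_trans alpha_A _; rewrite expr2 ler_peMr// ltW.
have B_delta : f w0 / eta + eta / (2 * c) < delta by move: B_small delta0; lra.
have /choice [g gP] : forall t : R, exists g : 'rV[R]_p, 0 <= t ->
    is_gradient (@edot R p) f (w t) g /\
    ((s - t)^-1 *: (w s - w t) @[s --> within [set s : R | 0 <= s] t^'] --> - g).
  move=> t; have [t0|_] := boolP (0 <= t); last by exists 0.
  by have [g g1 g2] := flow t t0; exists g.
have g_grad t : 0 <= t -> is_gradient (@edot R p) f (w t) (g t).
  by move=> /gP[].
have w_flow t : 0 <= t ->
    (s - t)^-1 *: (w s - w t) @[s --> within [set s : R | 0 <= s] t^'] --> - g t.
  by move=> /gP[].
exists (lim (w t @[t --> +oo])).
  exact: (flow_limit_local_minimum f_ge0 f_cont delta0 c0 eta0 f_PL B_delta w_0 g_grad).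
move=> t t0; apply: le_trans (flow_rate f_ge0 delta0 c0 eta0 f_PL B_delta w_0 g_grad w_flow t0) _.
rewrite ler_wpM2r ?expR_ge0// (le_trans B_small)//.
by move: delta0; lra.
Qed.
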